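(* (a) Fix $\epsilon>0$. For all sufficiently large $d$ the following holds: if $n\ge(\pi/4+\epsilon)\,d^2/\log d$ and $u_1,\dots,u_n,v_1,\dots,v_n$ are i.i.d. $\mathcal N(0,I_d/d)$ in $\mathbb R^d$, then with probability at least $1-e^{-\Omega(d)}$ there is no matrix $W\in\mathbb R^{d\times d}$ such that $u_i^\top Wv_i>u_j^\top Wv_i$ for all $i\in[n]$ and all $j\ne i$. (b) More generally, suppose $u_1,\dots,u_n$ are i.i.d. $\mathcal N(0,I_d/d)$ and $v_1,\dots,v_n\in\mathbb R^d\setminus\{0\}$ satisfy, with fixed implicit constants, $\|v_i\|\lesssim 1$ for all $i$, $\frac1n\sum_i v_iv_i^\top\succeq \frac{c}{d}I_d$ for some constant $c>0$, and $\big\|\frac1n\sum_i v_i^{\otimes 4}\big\|\lesssim d^{-2}$. Then there is a constant $C$ (depending only on these implicit constants) such that for all sufficiently large $d$, if $n\ge C\,d^2/\log d$, then with probability at least $1-e^{-\Omega(d)}$ no such $W$ exists.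
   Context: $\|\cdot\|$ on the symmetric 4-tensor $\frac1n\sum_i v_i^{\otimes4}$ denotes the injective (operator) norm $\sup_{\|x\|=1}\frac1n\sum_i\langle v_i,x\rangle^4$. The notation $\lesssim$ means bounded by a fixed constant multiple independent of $n,d$. *)

(* Defs.v *)
From HB Require Import structures.
From mathcomp Require Import all_boot all_order all_algebra.
From mathcomp Require Import all_classical all_reals all_analysis.
From mathcomp Require Import normal_distribution.
Set Implicit Arguments. Unset Strict Implicit. Unset Printing Implicit Defensive.
Import Order.TTheory GRing.Theory Num.Theory.
Local Open Scope classical_set_scope.
Local Open Scope ring_scope.

Section Defs.
Variable R : realType.

Definition scons (x : R) (y : nat -> R) : nat -> R :=
  fun k => if k is k'.+1 then y k' else x.

(* Expectation of a nonnegative functional F of m i.i.d. N(0, s^2) real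
   coordinates w 0, ..., w (m-1) (coordinates >= m are unused, set to 0),
   computed as the iterated integral against the product Gaussian measure. *)
Fixpoint gauss_iter (s : R) (m : nat) (F : (nat -> R) -> \bar R) : \bar R :=
  match m with
  | 0 => F (fun _ => 0)
  | m'.+1 => (\int[normal_prob 0 s]_x gauss_iter s m' (fun y => F (scons x y)))%E
  end.

Definition gauss_prob (s : R) (m : nat) (A : set (nat -> R)) : \bar R :=
  gauss_iter s m (fun w => (\1_A w)%:E).

(* standard deviation of each coordinate of N(0, I_d / d) *)
Definition sd_of (d : nat) : R := (Num.sqrt d%:R)^-1.

Definition dotv (d : nat) (x y : 'I_d -> R) : R := \sum_(k < d) x k * y k.
Definition enorm (d : nat) (x : 'I_d -> R) : R := Num.sqrt (dotv x x).

Definition bilin (d : nat) (u : 'I_d -> R) (W : 'I_d -> 'I_d -> R)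
  (v : 'I_d -> R) : R := \sum_(k < d) \sum_(l < d) u k * W k l * v l.

Definition separable (n d : nat) (u v : 'I_n -> 'I_d -> R) : Prop :=
  exists W : 'I_d -> 'I_d -> R,
    forall i j : 'I_n, j != i -> bilin (u j) W (v i) < bilin (u i) W (v i).

(* reading n d-vectors out of the coordinate sequence w, starting at block b *)
Definition vecs (n d b : nat) (w : nat -> R) : 'I_n -> 'I_d -> R :=
  fun i k => w ((b + i) * d + k)%N.

End Defs.

Arguments scons {R} x y _.
Arguments gauss_iter {R} s m F.
Arguments gauss_prob {R} s m A.
Arguments sd_of R d.
Arguments dotv {R d} x y.
Arguments enorm {R d} x.
Arguments bilin {R d} u W v.
Arguments separable {R n d} u v.
Arguments vecs {R} n d b w _ _.

(* Main.v *)
(** Suppose [W] separates. Then [u_i^T W v_i >= max_j <u_j, W v_i>] for all [i].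
    Uniformly in [y], [max_j <u_j, y> >= (1 - o(1)) sqrt (2 ln d / d) |y|], so
    summing over [i] gives, with [M = sum_i u_i v_i^T],
      [|W|_F |M|_F >= <W, M> >= (1 - o(1)) sqrt (2 ln d / d) sum_i |W v_i|].
    Conditionally on one of the two families, [|M|_F^2] is a Gaussian quadratic
    form, and concentrates below [(1 + o(1)) n] as soon as that family has
    operator norm [(1 + o(1)) n / d].
    In (a), the triangle inequality applied to the rows of [W] reduces the lower
    bound of [sum_i |W v_i|] to [sum_i |<v_i, x>| >= (1 - o(1)) sqrt (2 / pi) n
    |x| / sqrt d], uniformly in [x]; comparing both sides yields
    [n <= (pi / 4 + o(1)) d^2 / ln d]. In (b), this lower bound comes from
    interpolating the first moment between the second and the fourth.
    Each uniform statement is a union bound over the [(2 d^2 + 1)^d] cells of a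
    grid: this crude net suffices because the pointwise failure probabilities
    are far below [exp (- C d ln d)]. *)
Require Import Defs.
From HB Require Import structures.
From mathcomp Require Import all_boot all_order all_algebra.
From mathcomp Require Import all_classical all_reals all_analysis.
From mathcomp Require Import measurable_realfun normal_distribution.
From mathcomp Require Import ring lra.
Set Implicit Arguments. Unset Strict Implicit. Unset Printing Implicit Defensive.
Import Order.TTheory GRing.Theory Num.Theory.
Import numFieldTopology.Exports numFieldNormedType.Exports.
Local Open Scope classical_set_scope.
Local Open Scope ring_scope.

(** * Gaussian integrals *)

(** The lower bound on a Gaussian maximum is the delicate estimate: it needs a lower bound on a
    Gaussian tail, whereas Chernoff's method gives upper bounds. [tilt] resolves this with a
    combination of three exponentials, so that independence still enters only through products of
    expectations. There is no upper bound on [n], so the coordinates of all the [u_i] cannot be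
    bounded with failure probability exponentially small in [d]. The maximum is therefore sought
    among the first [min(n, d^2)] vectors only, which already suffices since the tail at level
    [(1 - del) sqrt (2 ln d)] is larger than [1/d]. Origin of pi/4: with [u] fixed, [|M|_F^2] is at
    most about [(1/d) (n/d) d^2 = n], while the squared lower factor is about
    [(2 ln d / d) (2 / pi) (n^2 / d)]. Separation forces the second to be at most the first. *)

Section normal_integral.
Context {R : realType}.
Local Notation mu := (@lebesgue_measure R).

Lemma integral_normal_prob (m s : R) (f : R -> \bar R) :
  measurable_fun setT f -> (forall x, 0 <= f x)%E ->
  (\int[normal_prob m s]_x f x =
   \int[mu]_x (f x * (normal_pdf m s x)%:E))%E.
Proof.
move=> mf f0.
have dom := normal_prob_dominates m s.
rewrite -(Radon_Nikodym_SigmaFinite.change_of_variables dom)//=.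
apply: ae_eq_integral => //=.
- apply: emeasurable_funM => //; apply: (measurable_int mu).
  exact: Radon_Nikodym_SigmaFinite.f_integrable.
- apply: emeasurable_funM => //; apply/measurable_EFinP.
  exact: measurable_normal_pdf.
(* The Radon-Nikodym derivative is determined only almost everywhere; it is identified with the
   density by comparing integrals over all measurable sets. *)
- apply: ae_eqe_mul2l => /=.
  apply: integral_ae_eq => //=.
  + exact: Radon_Nikodym_SigmaFinite.f_integrable.
  + by apply/measurable_EFinP; exact: measurable_normal_pdf.
  + by move=> E _ mE; rewrite -Radon_Nikodym_SigmaFinite.f_integral.
Qed.

(* Integrals of nonnegative functions are suprema over simple functions below,
   so no measurability is needed for monotonicity. *)
Lemma ge0_le_integralT (d : measure_display) (T : measurableType d)
  (nu : {measure set T -> \bar R}) (f g : T -> \bar R) :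
  (forall x, 0 <= f x)%E -> (forall x, f x <= g x)%E ->
  (\int[nu]_x f x <= \int[nu]_x g x)%E.
Proof.
move=> f0 fg; rewrite !ge0_integralTE//; last first.
  by move=> x; exact: le_trans (fg x).
apply: le_ereal_sup => _ [h /= hf <-].
by exists h => //= x; exact: le_trans (hf x) (fg x).
Qed.
End normal_integral.

(** * Iterated Gaussian integrals: linearity, concatenation, independent blocks *)

Section gauss_iter_theory.
Context {R : realType}.
Local Open Scope ereal_scope.
Implicit Types (s : R) (m : nat) (F : (nat -> R) -> \bar R).

(* Measurability in the coordinates, tested on all measurable families of
   coordinates: this is measurability for the product sigma-algebra, in a form
   that is stable under composition by construction. *)
Definition jmeasurable (d : measure_display) (T : measurableType d)
    (G : T -> (nat -> R) -> \bar R) : Prop :=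
  forall (d' : measure_display) (T' : measurableType d') (p : T' -> T)
    (f : nat -> T' -> R), measurable_fun setT p ->
    (forall k, measurable_fun setT (f k)) ->
    measurable_fun setT (fun t => G (p t) (f ^~ t)).

Definition cmeasurable F : Prop :=
  forall (d' : measure_display) (T' : measurableType d')
    (f : nat -> T' -> R), (forall k, measurable_fun setT (f k)) ->
    measurable_fun setT (fun t => F (f ^~ t)).

Lemma scons_fam (T : Type) (x : T -> R) (f : nat -> T -> R) (t : T) :
  scons (x t) (f ^~ t) = (fun k => (if k is k'.+1 then f k' else x) t).
Proof. by apply/funext => -[]. Qed.

Lemma measurable_scons_fam (d : measure_display) (T : measurableType d)
    (x : T -> R) (f : nat -> T -> R) :
  measurable_fun setT x -> (forall k, measurable_fun setT (f k)) ->
  forall k, measurable_fun setT (if k is k'.+1 then f k' else x).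
Proof. by move=> mx mf []. Qed.

Lemma gauss_iter_ge0 s m F : (forall w, 0 <= F w) -> 0 <= gauss_iter s m F.
Proof.
elim: m F => [|m IH] F F0 //=.
by apply: integral_ge0 => x _; apply: IH.
Qed.

Lemma le_gauss_iter s m F F' : (forall w, 0 <= F w) ->
  (forall w, F w <= F' w) -> gauss_iter s m F <= gauss_iter s m F'.
Proof.
elim: m F F' => [|m IH] F F' F0 FF' //=.
apply: ge0_le_integralT => x; first exact: gauss_iter_ge0.
exact: IH.
Qed.

(** The parameter space is generalised in the induction: peeling off one coordinate enlarges [T] to
    [T * R], and Tonelli then integrates that coordinate out. *)
Lemma measurable_gauss_iter s m (d : measure_display) (T : measurableType d)
    (G : T -> (nat -> R) -> \bar R) : (forall t w, 0 <= G t w) ->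
  jmeasurable G -> measurable_fun setT (fun t => gauss_iter s m (G t)).
Proof.
elim: m d T G => [|m IH] d T G G0 mG /=.
  by apply: (mG _ _ id (fun _ _ => 0%R)) => //; exact: measurable_id.
have := @measurable_fun_fubini_tonelli_F _ _ T _ R (normal_prob 0 s)
  (fun tx => gauss_iter s m (fun y => G tx.1 (scons tx.2 y))).
apply; last by move=> tx; exact: gauss_iter_ge0.
apply: (IH _ _ (fun tx y => G tx.1 (scons tx.2 y))) => // d' T' p f mp mf.
rewrite [X in measurable_fun _ X](_ : _ = fun t => G (fst (p t)) (fun k =>
  (if k is k'.+1 then f k' else (snd \o p)) t)); last first.
  by apply/funext => t; rewrite -(scons_fam (snd \o p)).
apply: (mG _ _ (fst \o p)); first exact: measurableT_comp.
by apply: measurable_scons_fam => //; exact: measurableT_comp.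
Qed.

Lemma cmeasurable_scons F (x : R) :
  cmeasurable F -> cmeasurable (fun y => F (scons x y)).
Proof.
move=> mF d' T' f mf.
rewrite [X in measurable_fun _ X](_ : _ = fun t => F (fun k =>
  (if k is k'.+1 then f k' else cst x) t)); last first.
  by apply/funext => t; rewrite -(scons_fam (cst x)).
by apply: mF; exact: measurable_scons_fam.
Qed.

Lemma measurable_gauss_iter_scons s m F : (forall w, 0 <= F w) ->
  cmeasurable F ->
  measurable_fun setT (fun x : R => gauss_iter s m (fun y => F (scons x y))).
Proof.
move=> F0 mF; apply: (@measurable_gauss_iter s m _ _ (fun x y => F (scons x y))) => //.
move=> d' T' p f mp mf.
rewrite [X in measurable_fun _ X](_ : _ = fun t => F (fun k =>
  (if k is k'.+1 then f k' else p) t)); last first.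
  by apply/funext => t; rewrite -(scons_fam p).
by apply: mF; exact: measurable_scons_fam.
Qed.

Lemma gauss_iterD s m F F' : (forall w, 0 <= F w) -> (forall w, 0 <= F' w) ->
  cmeasurable F -> cmeasurable F' ->
  gauss_iter s m (fun w => F w + F' w) = gauss_iter s m F + gauss_iter s m F'.
Proof.
elim: m F F' => [|m IH] F F' F0 F'0 mF mF' //=.
rewrite -ge0_integralD//; first last.
- exact: measurable_gauss_iter_scons.
- by move=> x _; exact: gauss_iter_ge0.
- exact: measurable_gauss_iter_scons.
- by move=> x _; exact: gauss_iter_ge0.
by apply: eq_integral => x _; rewrite IH//; exact: cmeasurable_scons.
Qed.

Lemma gauss_iterZl s m F (k : \bar R) : 0 <= k -> (forall w, 0 <= F w) ->
  cmeasurable F -> gauss_iter s m (fun w => k * F w) = k * gauss_iter s m F.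
Proof.
move=> k0; elim: m F => [|m IH] F F0 mF //=.
rewrite -ge0_integralZl//; first last.
- by move=> x _; exact: gauss_iter_ge0.
- exact: measurable_gauss_iter_scons.
by apply: eq_integral => x _; rewrite IH//; exact: cmeasurable_scons.
Qed.

Lemma gauss_iter_cst s m (c : \bar R) : gauss_iter s m (fun _ => c) = c.
Proof.
elim: m => [|m IH] //=; rewrite IH.
by rewrite (integral_cst (normal_prob 0 s))// [X in _ * X]probability_setT mule1.
Qed.

Lemma gauss_iter_sum s m (I : Type) (r : seq I) (F : I -> (nat -> R) -> \bar R) :
  (forall i w, 0 <= F i w) -> (forall i, cmeasurable (F i)) ->
  gauss_iter s m (fun w => \sum_(i <- r) F i w) =
  \sum_(i <- r) gauss_iter s m (F i).
Proof.
move=> F0 mF; elim: r => [|i r IH].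
  rewrite big_nil; under [X in gauss_iter _ _ X]funext do rewrite big_nil.
  by rewrite gauss_iter_cst.
rewrite big_cons -IH -gauss_iterD//; first last.
- by move=> d' T' f mf; apply: emeasurable_sum => j; exact: mF.
- by move=> w; exact: sume_ge0.
by congr gauss_iter; apply/funext => w; rewrite big_cons.
Qed.

(** [F] is not assumed measurable, so it is replaced by its measurable minorant [max(0, a - H)];
    additivity applies to this minorant and [H], whose sum is at least [a]. *)
Lemma gauss_iter_lb s m F (H : (nat -> R) -> R) (a p : R) : (0 <= a)%R ->
  (forall w, 0 <= F w) -> (forall w, 0 <= H w)%R ->
  cmeasurable (fun w => (H w)%:E) ->
  (forall w, (a - H w)%:E <= F w) -> gauss_iter s m (fun w => (H w)%:E) <= p%:E ->
  (a - p)%:E <= gauss_iter s m F.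
Proof.
move=> a0 F0 H0 mH aHF Hp.
pose F' w := maxe 0 (a - H w)%:E.
have mF' : cmeasurable F'.
  move=> d' T' f mf; apply: measurable_maxe => //.
  under eq_fun do rewrite EFinB.
  by apply: emeasurable_funB => //; exact: mH.
have F'0 w : 0 <= F' w by rewrite le_max lexx.
have F'F : gauss_iter s m F' <= gauss_iter s m F.
  by apply: le_gauss_iter => // w; rewrite ge_max F0 aHF.
have : a%:E <= gauss_iter s m F' + gauss_iter s m (fun w => (H w)%:E).
  have HE0 w : 0 <= (H w)%:E by rewrite lee_fin.
  rewrite -gauss_iterD//.
  rewrite -[leLHS](gauss_iter_cst s m); apply: le_gauss_iter.
    by move=> w; rewrite lee_fin.
  move=> w; rewrite /F' -[leLHS](_ : (a - H w)%:E + (H w)%:E = _).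
    by rewrite leeD2r// le_max lexx orbT.
  by rewrite -EFinD subrK.
move=> aH; rewrite EFinB leeBlDr//; apply: le_trans aH _.
exact: leeD.
Qed.

Definition catw (d : nat) (w w' : nat -> R) : nat -> R :=
  fun k => if (k < d)%N then w k else w' (k - d)%N.

Lemma gauss_iter_cat s d m F : gauss_iter s (d + m) F =
  gauss_iter s d (fun w => gauss_iter s m (fun w' => F (catw d w w'))).
Proof.
elim: d F => [|d IH] F /=.
  rewrite add0n; congr gauss_iter; apply/funext => w'; congr F.
  by apply/funext => k; rewrite /catw subn0.
apply: eq_integral => x _; rewrite IH; congr gauss_iter; apply/funext => w.
congr gauss_iter; apply/funext => w'; congr F.
by apply/funext => -[|k] //; rewrite /catw /= ltnS subSS.
Qed.

Definition vmeasurable (d : nat) (f : ('I_d -> R) -> R) : Prop :=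
  forall (d' : measure_display) (T' : measurableType d')
    (g : 'I_d -> T' -> R), (forall k, measurable_fun setT (g k)) ->
    measurable_fun setT (fun t => f (g ^~ t)).

Lemma vmeasurable_cmeasurable (d : nat) (f : ('I_d -> R) -> R) (j : 'I_d -> nat) :
  vmeasurable f -> cmeasurable (fun w => (f (fun k => w (j k)))%:E).
Proof.
move=> mf d' T' g mg; apply/measurable_EFinP.
by apply: (mf _ _ (fun k t => g (j k) t)) => k; exact: mg.
Qed.

(** Independence of the blocks, in the form consumed by Chernoff bounds. The family [f] is indexed
    by all naturals so that the induction can shift it by one block. *)
Lemma gauss_iter_blocks s (d n : nat) (f : nat -> ('I_d -> R) -> R)
    (p : nat -> R) :
  (forall i v, 0 <= f i v)%R -> (forall i, vmeasurable (f i)) ->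
  (forall i, (i < n)%N ->
     gauss_iter s d (fun w => (f i (fun k => w k))%:E) <= (p i)%:E) ->
  gauss_iter s (n * d)
    (fun w => (\prod_(i < n) f i (fun k => w (i * d + k)%N))%:E)
  <= (\prod_(i < n) p i)%:E.
Proof.
elim: n f p => [|n IH] f p f0 mf fp.
  by rewrite mul0n /= !big_ord0.
have p0 i : (i < n.+1)%N -> (0 <= p i)%R.
  move=> ilt; rewrite -lee_fin; apply: le_trans (fp i ilt).
  by apply: gauss_iter_ge0 => w; rewrite lee_fin.
rewrite mulSn gauss_iter_cat big_ord_recl.
pose P := (\prod_(i < n) p i.+1)%R.
have P0 : (0 <= P)%R by apply: prodr_ge0 => i _; apply: p0; rewrite ltnS.
apply: (@le_trans _ _ (gauss_iter s d (fun w => P%:E * (f 0%N (fun k => w k))%:E))).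
  apply: le_gauss_iter => w.
    by apply: gauss_iter_ge0 => w'; rewrite lee_fin; apply: prodr_ge0 => ? _; exact: f0.
  rewrite (_ : (fun w' => _) = fun w' => (f 0%N (fun k => w k))%:E *
      (\prod_(i < n) f i.+1 (fun k => w' (i * d + k)%N))%:E); last first.
    apply/funext => w'; rewrite -EFinM big_ord_recl; congr (_ * _)%R%:E.
      by congr (f 0%N); apply/funext => k; rewrite /catw /= mul0n add0n ltn_ord.
    apply: eq_bigr => i _; rewrite lift0; congr (f _ _); apply/funext => k.
    by rewrite /catw mulSn -addnA ltnNge leq_addr /= addKn.
  rewrite gauss_iterZl ?lee_fin//; first last.
  - move=> d' T' g mg; apply/measurable_EFinP; apply: measurable_prod => i _.
    by apply: (mf _ _ _ (fun k t => g (i * d + k)%N t)) => k; exact: mg.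
  - by move=> w'; rewrite lee_fin; apply: prodr_ge0 => ? _; exact: f0.
  rewrite muleC; apply: lee_wpmul2r; first by rewrite lee_fin.
  by apply: (IH (fun i => f i.+1) (fun i => p i.+1)) => // i ilt; exact: fp.
rewrite gauss_iterZl ?lee_fin//; first last.
- exact: vmeasurable_cmeasurable.
- by move=> w; rewrite lee_fin.
rewrite mulrC EFinM; apply: lee_wpmul2l; first by rewrite lee_fin.
exact: fp.
Qed.
End gauss_iter_theory.

(** * One-dimensional Gaussian identities and convolution *)

Section normal_1d.
Context {R : realType}.
Local Notation mu := (@lebesgue_measure R).
Local Notation N01 := (normal_prob (0 : R) 1).
Implicit Types (f : R -> R) (s x : R).

Lemma normal_peakE s : 0 < s -> normal_peak s = s^-1 * normal_peak 1.
Proof.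
move=> s0; rewrite /normal_peak -invfM; congr (_^-1).
rewrite (_ : s ^+ 2 * pi *+ 2 = s ^+ 2 * (1 ^+ 2 * pi *+ 2)); last first.
  by rewrite expr1n mul1r mulrnAr.
by rewrite sqrtrM ?sqr_ge0// sqrtr_sqr gtr0_norm.
Qed.

Lemma integral_normal_expR s (a : R) : s != 0 ->
  (\int[normal_prob 0 s]_x (expR (a * x))%:E = (expR (s ^+ 2 * a ^+ 2 / 2))%:E)%E.
Proof.
move=> s0; rewrite integral_normal_prob//; last first.
  by apply/measurable_EFinP; apply: measurableT_comp => //; exact: measurable_funM.
transitivity (\int[mu]_x ((expR (s ^+ 2 * a ^+ 2 / 2))%:E *
    (normal_pdf (a * s ^+ 2) s x)%:E))%E.
  apply: eq_integral => x _; rewrite -!EFinM !normal_pdfE//= /normal_fun; congr (_%:E).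
  rewrite mulrCA [RHS]mulrCA -!expRD; congr (_ * expR _).
  by field; rewrite s0.
rewrite ge0_integralZl//; first by rewrite integral_normal_pdf mule1.
- by apply/measurable_EFinP; exact: measurable_normal_pdf.
- by move=> x _; rewrite lee_fin normal_pdf_ge0.
Qed.

Lemma integral_normal_expR_sqr (th : R) : th < 2^-1 ->
  (\int[N01]_x (expR (th * x ^+ 2))%:E = ((Num.sqrt (1 - 2 * th))^-1)%:E)%E.
Proof.
move=> th2; have q0 : 0 < 1 - 2 * th by lra.
set q := Num.sqrt (1 - 2 * th); have qp : 0 < q by rewrite sqrtr_gt0.
have q2 : q ^+ 2 = 1 - 2 * th by rewrite sqr_sqrtr// ltW.
rewrite integral_normal_prob//; last first.
  apply/measurable_EFinP; apply: measurableT_comp => //; apply: measurable_funM => //.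
transitivity (\int[mu]_x ((q^-1)%:E * (normal_pdf 0 q^-1 x)%:E))%E.
  apply: eq_integral => x _; rewrite -!EFinM !normal_pdfE ?oner_neq0 ?invr_neq0 ?gt_eqF//=.
  congr (_%:E); rewrite (@normal_peakE q^-1) ?invr_gt0// invrK.
  rewrite [RHS]mulrA mulKf ?gt_eqF// mulrCA /normal_fun -expRD.
  congr (_ * expR _); rewrite exprVn q2.
  by field; rewrite gt_eqF.
rewrite ge0_integralZl//; first by rewrite integral_normal_pdf mule1.
- by apply/measurable_EFinP; exact: measurable_normal_pdf.
- by move=> x _; rewrite lee_fin normal_pdf_ge0.
- by rewrite lee_fin invr_ge0 ltW.
Qed.

Lemma integral_lebesgueN (g : R -> \bar R) : measurable_fun setT g ->
  (forall x, 0 <= g x)%E -> (\int[mu]_x g (- x)%R = \int[mu]_x g x)%E.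
Proof.
move=> mg g0.
rewrite -[RHS](@eq_measure_integral _ _ _ _ _ (pushforward mu (-%R : R -> measurableTypeR R))); last first.
  by move=> A mA _; exact: lebesgue_measureN.
by rewrite ge0_integral_pushforward// preimage_setT.
Qed.

Lemma integral_affine f (c t : R) : 0 < t -> continuous f ->
  (forall x, 0 <= f x) ->
  (\int[mu]_x (f x)%:E = \int[mu]_x (f (c + t * x) * t)%:E)%E.
Proof.
move=> t0 cf f0.
pose F x := t * x + c.
have dF x : is_derive x (1:R) F t.
  rewrite /F; apply: is_derive_eq; rewrite ?scaler0 ?addr0 ?add0r.
  by rewrite /GRing.scale /= mulr1.
have F'E : F^`()%classic = cst t.
  by apply/funext => x; rewrite derive1E; exact: derive_val.
rewrite (@increasing_ge0_integration_by_substitutionT _ F)//.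
- by apply: eq_integral => x _; rewrite F'E /= /F addrC.
- by move=> x y xy; rewrite /F ltrD2r ltr_pM2l.
- by rewrite F'E => x; exact: cvg_cst.
- by rewrite F'E; exact: is_cvg_cst.
- by rewrite F'E; exact: is_cvg_cst.
- rewrite (_ : F = fun x => (x + c / t) * t); last first.
    by apply/funext => x; rewrite /F mulrDl divfK ?gt_eqF// mulrC.
  by apply: gt0_cvgMlNy => //; exact: cvg_addrr_Ny.
- rewrite (_ : F = fun x => (x + c / t) * t); last first.
    by apply/funext => x; rewrite /F mulrDl divfK ?gt_eqF// mulrC.
  by apply: gt0_cvgMly => //; exact: cvg_addrr.
Qed.

Lemma integral_normal_affine f (c t : R) : 0 < t -> continuous f ->
  (forall x, 0 <= f x) ->
  (\int[N01]_x (f (c + t * x))%:E = \int[mu]_x (f x * normal_pdf c t x)%:E)%E.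
Proof.
move=> t0 cf f0.
have cft : continuous (fun x => f (c + t * x)).
  move=> x; apply: continuous_comp; last exact: cf.
  by apply: cvgD; [exact: cvg_cst|apply: cvgM; [exact: cvg_cst|exact: cvg_id]].
rewrite integral_normal_prob; first last.
- by move=> x; rewrite lee_fin.
- by apply/measurable_EFinP; exact: continuous_measurable_fun.
rewrite (@integral_affine (fun x => f x * normal_pdf c t x) c t)//; first last.
- by move=> x; rewrite mulr_ge0// normal_pdf_ge0.
- move=> x; apply: cvgM; first exact: cf.
  by apply: continuous_normal_pdf; rewrite gt_eqF.
apply: eq_integral => x _; rewrite -EFinM -mulrA; congr (_ * _)%:E.
rewrite !normal_pdfE ?oner_neq0 ?gt_eqF// (@normal_peakE t)//.
rewrite mulrAC [_ * t]mulrAC mulVf ?gt_eqF// mul1r /normal_fun; congr (_ * expR _).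
by field; rewrite gt_eqF.
Qed.

(** Completing the square: for [X] of law N(0, s^2) and [Z = a X + t Y], the joint density of
    [(X, Z)] factors as the marginal of [Z] times the conditional density of [X] given [Z]. *)
Lemma normal_pdf_mul s (t r a x z : R) : 0 < s -> 0 < t -> 0 < r ->
  r ^+ 2 = s ^+ 2 * a ^+ 2 + t ^+ 2 ->
  normal_pdf (a * x) t z * normal_pdf 0 s x =
  normal_pdf 0 r z * normal_pdf (s ^+ 2 * a * z / r ^+ 2) (s * t / r) x.
Proof.
move=> s0 t0 rp r2.
have st : 0 < s * t / r by rewrite divr_gt0// mulr_gt0.
have sn0 := lt0r_neq0 s0; have tn0 := lt0r_neq0 t0.
have rn0 := lt0r_neq0 rp; have stn0 := lt0r_neq0 st.
rewrite (normal_pdfE (a * x) tn0) (normal_pdfE 0 sn0) (normal_pdfE 0 rn0).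
rewrite (normal_pdfE _ stn0) (normal_peakE s0) (normal_peakE t0).
rewrite (normal_peakE rp) (normal_peakE st) /normal_fun.
have -> : (s * t / r)^-1 = s^-1 * t^-1 * r by field; rewrite sn0 tn0 rn0.
set p := normal_peak 1; rewrite !subr0.
rewrite mulrACA -expRD [RHS]mulrACA -expRD.
have -> : r^-1 * p * (s^-1 * t^-1 * r * p) = t^-1 * p * (s^-1 * p).
  by field; rewrite sn0 tn0 rn0.
congr (_ * expR _).
have -> : (s * t / r) ^+ 2 = s ^+ 2 * t ^+ 2 / r ^+ 2.
  by rewrite expr_div_n exprMn.
have r2n0 : s ^+ 2 * a ^+ 2 + t ^+ 2 != 0 by rewrite -r2 expf_neq0.
by rewrite r2; field; rewrite exprMn r2n0 sn0 tn0.
Qed.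

(** After Tonelli and [normal_pdf_mul], the conditional density of [x] integrates to 1 and only the
    marginal N(0, r^2) remains. *)
Lemma integral_normal_convolution f s (a t : R) : 0 < s -> 0 < t ->
  continuous f -> (forall x, 0 <= f x) ->
  (\int[normal_prob 0 s]_x \int[N01]_y (f (a * x + t * y))%:E =
   \int[N01]_x (f (Num.sqrt (s ^+ 2 * a ^+ 2 + t ^+ 2) * x))%:E)%E.
Proof.
move=> s0 t0 cf f0.
set r := Num.sqrt _.
have r2 : r ^+ 2 = s ^+ 2 * a ^+ 2 + t ^+ 2.
  by rewrite sqr_sqrtr//; apply: addr_ge0; [apply: mulr_ge0|]; exact: sqr_ge0.
have rp : 0 < r.
  rewrite sqrtr_gt0; apply: ltr_wpDl; last exact: exprn_gt0.
  by apply: mulr_ge0; exact: sqr_ge0.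
have mf := continuous_measurable_fun cf.
pose K (xz : measurableTypeR R * measurableTypeR R) :=
  f xz.2 * normal_pdf (a * xz.1) t xz.2 * normal_pdf 0 s xz.1.
have K0 xz : 0 <= K xz by rewrite /K !mulr_ge0 ?normal_pdf_ge0.
have mK0 : measurable_fun setT (fun xz : measurableTypeR R * measurableTypeR R =>
     f xz.2 * normal_pdf (a * xz.1) t xz.2).
  apply: measurable_funM; first exact: measurableT_comp.
  rewrite (_ : (fun xz => _) = fun xz : measurableTypeR R * measurableTypeR R =>
      normal_peak t * expR (- (xz.2 - a * xz.1) ^+ 2 / (t ^+ 2 *+ 2))).
    apply: measurable_funM => //; apply: measurableT_comp => //.
    apply: measurable_funM => //; apply: measurableT_comp => //.
    apply: measurable_funX; apply: measurable_funB; first exact: measurable_snd.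
    by apply: measurable_funM => //; exact: measurable_fst.
  by apply/funext => xz; rewrite normal_pdfE ?gt_eqF.
have mK : measurable_fun setT K.
  apply: measurable_funM => //; apply: measurableT_comp; last exact: measurable_fst.
  exact: measurable_normal_pdf.
have inner x : (\int[N01]_y (f (a * x + t * y))%:E =
    \int[mu]_z (f z * normal_pdf (a * x) t z)%:E)%E.
  exact: (integral_normal_affine (a * x) t0).
under eq_integral do rewrite inner.
rewrite [LHS]integral_normal_prob; first last.
- by move=> x; apply: integral_ge0 => z _; rewrite lee_fin mulr_ge0// normal_pdf_ge0.
- apply: (@measurable_fun_fubini_tonelli_F _ _ _ _ R mu (fun xz =>
     (f xz.2 * normal_pdf (a * xz.1) t xz.2)%:E)); first exact/measurable_EFinP.
  by move=> xz; rewrite lee_fin mulr_ge0// normal_pdf_ge0.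
transitivity (\int[mu]_x \int[mu]_z (K (x, z))%:E)%E.
  apply: eq_integral => x _; rewrite muleC -ge0_integralZl//.
  - by apply: eq_integral => z _; rewrite -EFinM mulrC.
  - apply/measurable_EFinP; apply: measurable_funM => //.
    exact: measurable_normal_pdf.
  - by move=> z _; rewrite lee_fin mulr_ge0// normal_pdf_ge0.
  - by rewrite lee_fin normal_pdf_ge0.
rewrite (fubini_tonelli (fun xz => (K xz)%:E)); first last.
- by move=> xz; rewrite lee_fin.
- exact/measurable_EFinP.
under [RHS]eq_integral do rewrite -[X in f X]add0r.
rewrite integral_normal_affine//; apply: eq_integral => z _.
transitivity (\int[mu]_x ((f z * normal_pdf 0 r z)%:E *
   (normal_pdf (s ^+ 2 * a * z / r ^+ 2) (s * t / r) x)%:E))%E.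
  apply: eq_integral => x _; rewrite -EFinM; congr (_%:E).
  by rewrite /K /= -[RHS]mulrA -normal_pdf_mul// mulrA.
rewrite ge0_integralZl//; first by rewrite integral_normal_pdf mule1.
- by apply/measurable_EFinP; exact: measurable_normal_pdf.
- by move=> x _; rewrite lee_fin normal_pdf_ge0.
- by rewrite lee_fin mulr_ge0// normal_pdf_ge0.
Qed.
End normal_1d.

(** * First absolute moment of the Gaussian and its Laplace transform *)

Section normal_abs.
Context {R : realType}.
Local Notation mu := (@lebesgue_measure R).
Local Notation N01 := (normal_prob (0 : R) 1).

(** [2 * normal_peak 1] is the mean of [|x|] under N(0, 1); its square is the source of pi in the
    threshold. *)
Lemma normal_peak1_sqr : (2 * normal_peak (1 : R)) ^+ 2 = 2 / pi.
Proof.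
rewrite /normal_peak; move: (pi : R) (pi_gt0 R) => p p0.
rewrite exprMn exprVn sqr_sqrtr; last first.
  by rewrite expr1n mul1r mulrn_wge0// ltW.
by rewrite expr1n mul1r -mulr_natr; field; exact: lt0r_neq0.
Qed.

Lemma integral_normal_abs :
  (\int[N01]_x (`|x|)%:E = (2 * normal_peak 1)%:E)%E.
Proof.
rewrite integral_normal_prob//; last by apply/measurable_EFinP.
pose g (x : R) := normal_peak 1 * (`|x| * expR (- (x ^+ 2 / 2))).
transitivity (\int[mu]_x (g x)%:E)%E.
  apply: eq_integral => x _; rewrite -EFinM normal_pdfE ?oner_neq0// mulrCA.
  by rewrite /normal_fun subr0 expr1n mulNr.
have cE : continuous (fun x : R => expR (- (x ^+ 2 / 2))).
  move=> x; apply: (@continuous_comp _ _ _ (fun x : R => - (x ^+ 2 / 2)) expR).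
    apply: cvgN; apply: cvgM; last exact: cvg_cst.
    exact: exprn_continuous.
  exact: continuous_expR.
rewrite ge0_symfun_integralT.
- rewrite (_ : [set x | _] = `[0, +oo[%classic); last first.
    by apply/seteqP; split => x/=; rewrite in_itv/= andbT.
  rewrite EFinM; congr (_ * _)%E.
  pose h (x : R) := normal_peak 1 * (x * expR (- (x ^+ 2 / 2))).
  pose F (x : R) := - normal_peak 1 * expR (- (x ^+ 2 / 2)).
  transitivity (\int[mu]_(x in `[0%R, +oo[) (h x)%:E)%E.
    apply: eq_integral => x /[!inE] /=; rewrite in_itv /= andbT => x0.
    by rewrite /g /h ger0_norm.
  have dF x : is_derive x (1:R) F (h x).
    rewrite /F /h; apply: is_derive_eq.
    rewrite /GRing.scale /=.
    by rewrite /GRing.scale /=; field.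
  have F0 : F 0 = - normal_peak 1 by rewrite /F expr0n /= mul0r oppr0 expR0 mulr1.
  have cF : continuous F.
    by move=> x; apply: cvgM; [exact: cvg_cst|exact: cE].
  rewrite (@ge0_continuous_FTC2y _ h F 0 0).
  + by rewrite F0 sub0e -EFinN opprK.
  + by move=> x x0; rewrite /h !mulr_ge0 ?normal_peak_ge0 ?expR_ge0.
  + apply: continuous_subspaceT => x; apply: cvgM; first exact: cvg_cst.
    by apply: cvgM; [exact: cvg_id|exact: cE].
  + rewrite -[X in _ --> X](mulr0 (- normal_peak 1)); apply: cvgM; first exact: cvg_cst.
    apply: (cvg_comp (fun x : R => x ^+ 2 / 2) (fun x => expR (- x))).
      by apply: gt0_cvgMly => //; exact: cvgr_expr2.
    exact: cvgr_expR.
  + by move=> x _; exact: ex_derive.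
  + by apply: cvg_at_right_filter; exact: cF.
  + by move=> x _; rewrite derive1E; exact: derive_val.
- by move=> x; rewrite /g !mulr_ge0 ?normal_peak_ge0 ?expR_ge0.
- move=> x; apply: cvgM; first exact: cvg_cst.
  by apply: cvgM; [exact: norm_continuous|exact: cE].
- by move=> x; rewrite /g /= normrN sqrrN.
Qed.

(** Follows from [expR y >= 1 + y] and [(1 + y) (1 - y + y^2) = 1 + y^3 >= 1]. *)
Lemma expRN_le (y : R) : 0 <= y -> expR (- y) <= 1 - y + y ^+ 2.
Proof.
move=> y0; rewrite expRN -[leLHS]mulr1 ler_pdivrMl ?expR_gt0//.
apply: (@le_trans _ _ ((1 + y) * (1 - y + y ^+ 2))); first by nra.
by apply: ler_wpM2r; [nra|exact: expR_ge1Dx].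
Qed.

(** Second-order expansion of the exponential, with [x^2] bounded by [4 expR (x^2 / 4)], whose mean
    is [4 sqrt 2 <= 6]. The linear term is kept on the left so that all integrands stay
    nonnegative. *)
Lemma integral_normal_expR_abs (l : R) : 0 <= l ->
  (\int[N01]_x (expR (- (l * `|x|)))%:E <=
   (1 - l * (2 * normal_peak 1) + 6 * l ^+ 2)%:E)%E.
Proof.
move=> l0.
have mexp : measurable_fun setT (fun x : R => expR (- (l * `|x|))).
  apply: measurableT_comp => //; apply: measurableT_comp => //.
  by apply: measurable_funM.
have mabs : measurable_fun setT (fun x : R => l * `|x|) by apply: measurable_funM.
have msq : measurable_fun setT (fun x : R => expR (4^-1 * x ^+ 2)).
  by apply: measurableT_comp => //; apply: measurable_funM.
have Hle : (\int[N01]_x ((expR (- (l * `|x|)))%:E + (l * `|x|)%:E) <=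
    \int[N01]_x (1 + (4 * l ^+ 2)%:E * (expR (4^-1 * x ^+ 2))%:E))%E.
  apply: ge0_le_integralT => x.
    by rewrite -EFinD lee_fin addr_ge0 ?expR_ge0// mulr_ge0.
  rewrite -EFinM -!EFinD lee_fin.
  have := @expRN_le (l * `|x|) (mulr_ge0 l0 (normr_ge0 x)).
  rewrite exprMn real_normK ?num_real//.
  have := expR_ge1Dx (4^-1 * x ^+ 2).
  set E := expR (4^-1 * _); set E' := expR _ => h1 h2.
  have : l ^+ 2 * x ^+ 2 <= l ^+ 2 * (4 * E).
    by apply: ler_wpM2l; [exact: sqr_ge0|lra].
  lra.
move: Hle; rewrite ge0_integralD//; first last.
- exact/measurable_EFinP.
- by move=> x _; rewrite lee_fin mulr_ge0.
- exact/measurable_EFinP.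
rewrite ge0_integralD//; first last.
- by apply/measurable_EFinP; apply: measurable_funM.
- by move=> x _; rewrite -EFinM lee_fin !mulr_ge0 ?sqr_ge0 ?expR_ge0.
rewrite (ge0_integralZl N01 measurableT (f := fun x => (expR (4^-1 * x ^+ 2))%:E))//; first last.
- by rewrite lee_fin mulr_ge0 ?sqr_ge0.
- exact/measurable_EFinP.
rewrite integral_normal_expR_sqr; last by lra.
rewrite (integral_cst N01)// [X in (1 * X)%E]probability_setT mul1e.
under [X in (_ + X <= _)%E]eq_integral do rewrite EFinM.
rewrite ge0_integralZl//; first last.
- exact/measurable_EFinP.
rewrite integral_normal_abs.
rewrite -!EFinM -EFinD => Hle.
apply: (@le_trans _ _ ((1 + 4 * l ^+ 2 / Num.sqrt (1 - 2 / 4)) - l * (2 * normal_peak 1))%:E).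
  by rewrite EFinB leeBrDr.
rewrite lee_fin.
have : (Num.sqrt (1 - 2 / 4))^-1 <= (3/2 : R).
  have q23 : 2 / 3 <= Num.sqrt (1 - 2 / 4) :> R.
    have -> : 2 / 3 = Num.sqrt ((2 / 3) ^+ 2) :> R by rewrite sqrtr_sqr ger0_norm.
    by rewrite ler_sqrt; lra.
  have qp : 0 < Num.sqrt (1 - 2 / 4) :> R by lra.
  by rewrite -(ler_pM2l qp) divff ?gt_eqF//; lra.
have := sqr_ge0 l; nra.
Qed.
End normal_abs.

(** * Linear forms and chi-square moments in several coordinates *)

Section gauss_linear.
Context {R : realType}.
Local Notation mu := (@lebesgue_measure R).
Local Notation N01 := (normal_prob (0 : R) 1).
Implicit Types (f : R -> R) (s : R).

Lemma continuous_shift f (a c : R) : continuous f ->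
  continuous (fun x => f (c + a * x)).
Proof.
move=> cf x; apply: continuous_comp; last exact: cf.
by apply: cvgD; [exact: cvg_cst|apply: cvgM; [exact: cvg_cst|exact: cvg_id]].
Qed.

Lemma integral_normalN f : continuous f -> (forall x, 0 <= f x) ->
  (\int[N01]_x (f (- x))%:E = \int[N01]_x (f x)%:E)%E.
Proof.
move=> cf f0; have mf := continuous_measurable_fun cf.
rewrite [RHS]integral_normal_prob; first last.
- by move=> x; rewrite lee_fin.
- exact/measurable_EFinP.
rewrite integral_normal_prob; first last.
- by move=> x; rewrite lee_fin.
- by apply/measurable_EFinP; apply: measurableT_comp.
rewrite -integral_lebesgueN.
- apply: eq_integral => x _; rewrite !normal_pdfE ?oner_neq0// /normal_fun.
  by rewrite opprK !subr0 sqrrN.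
- apply/measurable_EFinP; apply: measurable_funM; first exact: measurableT_comp.
  exact: measurable_normal_pdf.
- by move=> x; rewrite -EFinM lee_fin mulr_ge0// normal_pdf_ge0.
Qed.

Lemma integral_normal_scale f s (a : R) : 0 < s -> continuous f ->
  (forall x, 0 <= f x) ->
  (\int[normal_prob 0 s]_x (f (a * x))%:E =
   \int[N01]_x (f (s * `|a| * x))%:E)%E.
Proof.
move=> s0 cf f0.
have cfa (b : R) : continuous (fun x : R => f (b * x)).
  move=> x; have := @continuous_shift f b 0 cf x.
  by under eq_fun do rewrite add0r.
rewrite integral_normal_prob; first last.
- by move=> x; rewrite lee_fin.
- by apply/measurable_EFinP; exact: continuous_measurable_fun.
under eq_integral do rewrite -EFinM.
rewrite -(@integral_normal_affine _ (fun x => f (a * x)) 0 s s0 (cfa a))//.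
under eq_integral do rewrite add0r mulrA [a * s]mulrC.
have [a0|a0] := leP 0 a; first by rewrite ger0_norm.
rewrite ltr0_norm// -(@integral_normalN (fun x => f (s * - a * x)))//.
by apply: eq_integral => x _; rewrite !mulrN !mulNr opprK.
Qed.

(** The law of a linear form depends only on the norm of its coefficients. The induction applies the
    hypothesis to the translate of [f] by the first term and then convolves. *)
Lemma gauss_iter_linear s m (a : nat -> R) f : 0 < s -> continuous f ->
  (forall x, 0 <= f x) ->
  gauss_iter s m (fun w => (f (\sum_(k < m) a k * w k))%:E) =
  (\int[N01]_x (f (s * Num.sqrt (\sum_(k < m) a k ^+ 2) * x))%:E)%E.
Proof.
move=> s0; elim: m a f => [|m IH] a f cf f0 /=.
  rewrite !big_ord0 sqrtr0 mulr0.
  under eq_integral do rewrite mul0r.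
  by rewrite (integral_cst N01)// [X in (_ * X)%E]probability_setT mule1.
set S := \sum_(k < m) a k.+1 ^+ 2.
have S0 : 0 <= S by apply: sumr_ge0 => i _; exact: sqr_ge0.
have inner x : gauss_iter s m (fun y => (f (\sum_(k < m.+1) a k * scons x y k))%:E)
   = (\int[N01]_z (f (a 0%N * x + s * Num.sqrt S * z))%:E)%E.
  have := IH (fun k => a k.+1) (fun z => f (a 0%N * x + z)).
  rewrite -/S => <-//.
  - congr gauss_iter; apply/funext => y; rewrite big_ord_recl /=.
    by congr (f (_ + _))%:E; apply: eq_bigr => i _; rewrite lift0.
  - move=> y; have := @continuous_shift f 1 (a 0%N * x) cf y.
    by under eq_fun do rewrite mul1r.
under eq_integral do rewrite inner.
rewrite big_ord_recl.
rewrite (_ : \sum_(i < m) a (lift ord0 i) ^+ 2 = S); last first.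
  by apply: eq_bigr => i _; rewrite lift0.
(* The convolution lemma needs a positive second variance, so vanishing remaining coefficients are
   treated apart. *)
have [S00|Sn0] := eqVneq S 0.
  rewrite S00 sqrtr0 mulr0 addr0 sqrtr_sqr -integral_normal_scale//.
  apply: eq_integral => x _.
  under eq_integral do rewrite mul0r addr0.
  by rewrite (integral_cst N01)// [X in (_ * X)%E]probability_setT mule1.
have Sp : 0 < S by rewrite lt_neqAle eq_sym Sn0.
rewrite integral_normal_convolution// ?mulr_gt0 ?sqrtr_gt0//.
apply: eq_integral => x _; congr (f (_ * x))%:E.
rewrite exprMn sqr_sqrtr// -mulrDr sqrtrM ?sqr_ge0// sqrtr_sqr.
by rewrite gtr0_norm.
Qed.

Lemma gauss_iter_expR s m (a : nat -> R) : 0 < s ->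
  gauss_iter s m (fun w => (expR (\sum_(k < m) a k * w k))%:E) =
  (expR (s ^+ 2 * (\sum_(k < m) a k ^+ 2) / 2))%:E.
Proof.
move=> s0; rewrite (gauss_iter_linear _ _ s0 (@continuous_expR R))//.
rewrite integral_normal_expR ?oner_neq0// expr1n mul1r exprMn sqr_sqrtr//.
by apply: sumr_ge0 => i _; exact: sqr_ge0.
Qed.

Lemma measurable_expR_sqr_sum (d : measure_display) (T : measurableType d) (th : R)
  r (f : nat -> T -> R) : (forall k, measurable_fun setT (f k)) ->
  measurable_fun setT (fun t => expR (th * \sum_(j < r) f j t ^+ 2)).
Proof.
move=> mf; apply: measurableT_comp => //; apply: measurable_funM => //.
by apply: measurable_sum => i; apply: measurable_funX.
Qed.

Lemma gauss_iter_expR_sqr (th : R) r : th < 2^-1 ->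
  gauss_iter 1 r (fun w => (expR (th * \sum_(j < r) w j ^+ 2))%:E) =
  ((Num.sqrt (1 - 2 * th))^-1 ^+ r)%:E.
Proof.
move=> th2; elim: r => [|r IH] /=; first by rewrite big_ord0 mulr0 expR0 expr0.
transitivity (\int[N01]_x (((Num.sqrt (1 - 2 * th))^-1 ^+ r)%:E *
   (expR (th * x ^+ 2))%:E))%E.
  apply: eq_integral => x _.
  rewrite (_ : (fun y => _) = (fun y : nat -> R => (expR (th * x ^+ 2))%:E *
     (expR (th * \sum_(j < r) y j ^+ 2))%:E)%E); last first.
    apply/funext => y; rewrite big_ord_recl /= mulrDr expRD EFinM.
    by congr (_ * (expR (_ * _))%:E)%E; apply: eq_bigr => i _; rewrite lift0.
  rewrite gauss_iterZl ?lee_fin ?expR_ge0//.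
    by rewrite IH muleC.
  by move=> d' T' f mf; apply/measurable_EFinP; exact: measurable_expR_sqr_sum.
rewrite ge0_integralZl//.
- by rewrite integral_normal_expR_sqr// -EFinM exprSr.
- by apply/measurable_EFinP; apply: measurableT_comp => //; apply: measurable_funM.
Qed.
End gauss_linear.

(** * Hubbard-Stratonovich and Chernoff bounds *)

Section gauss_swap.
Context {R : realType}.
Local Open Scope ereal_scope.

Lemma integral_gauss_iter_swap (s s' : R) r
    (L : measurableTypeR R -> (nat -> R) -> \bar R) :
  (forall x w, 0 <= L x w) -> jmeasurable L ->
  \int[normal_prob 0 s]_x gauss_iter s' r (L x) =
  gauss_iter s' r (fun g => \int[normal_prob 0 s]_x L x g).
Proof.
elim: r L => [|r IH] L L0 mL; [reflexivity|cbn [gauss_iter]].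
pose G (xy : measurableTypeR R * measurableTypeR R) :=
  gauss_iter s' r (fun g => L xy.1 (scons xy.2 g)).
have G0 xy : 0 <= G xy by exact: gauss_iter_ge0.
have mG : measurable_fun setT G.
  apply: (@measurable_gauss_iter _ _ _ _ (measurableTypeR R * measurableTypeR R)%type
    (fun xy g => L xy.1 (scons xy.2 g))) => // d' T' p f mp mf.
  rewrite [X in measurable_fun _ X](_ : _ = fun t => L (fst (p t)) (fun k =>
    (if k is k'.+1 then f k' else (snd \o p)) t)); last first.
    by apply/funext => t; rewrite -(scons_fam (snd \o p)).
  apply: (mL _ _ (fst \o p)); first exact: measurableT_comp.
  by apply: measurable_scons_fam => //; exact: measurableT_comp.
transitivity (\int[normal_prob 0 s']_y \int[normal_prob 0 s]_x G (x, y)).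
  exact: (@fubini_tonelli _ _ _ _ R (normal_prob 0 s) (normal_prob 0 s') G mG G0).
apply: eq_integral => y _; rewrite -IH// => d' T' p f mp mf.
rewrite [X in measurable_fun _ X](_ : _ = fun t => L (p t) (fun k =>
  (if k is k'.+1 then f k' else cst y) t)); last first.
  by apply/funext => t; rewrite -(scons_fam (cst y)).
by apply: mL => //; exact: measurable_scons_fam.
Qed.

Lemma gauss_iter_swap (s s' : R) m r (K : (nat -> R) -> (nat -> R) -> \bar R) :
  (forall w g, 0 <= K w g) ->
  (forall (d : measure_display) (T : measurableType d) (f g : nat -> T -> R),
    (forall k, measurable_fun setT (f k)) ->
    (forall k, measurable_fun setT (g k)) ->
    measurable_fun setT (fun t => K (f ^~ t) (g ^~ t))) ->
  gauss_iter s m (fun w => gauss_iter s' r (K w)) =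
  gauss_iter s' r (fun g => gauss_iter s m (K ^~ g)).
Proof.
elim: m K => [|m IH] K K0 mK; [reflexivity|cbn [gauss_iter]].
rewrite -(@integral_gauss_iter_swap s s' r
  (fun x g => gauss_iter s m (fun w => K (scons x w) g))).
- apply: eq_integral => x _; rewrite -IH// => d T f g mf mg.
  rewrite [X in measurable_fun _ X](_ : _ = fun t => K (fun k =>
    (if k is k'.+1 then f k' else cst x) t) (g ^~ t)); last first.
    by apply/funext => t; rewrite -(scons_fam (cst x)).
  by apply: mK => //; exact: measurable_scons_fam.
- by move=> x g; exact: gauss_iter_ge0.
- move=> d T p g mp mg.
  apply: (@measurable_gauss_iter _ _ _ _ _
    (fun t w => K (scons (p t) w) (g ^~ t))) => // d' T' p' f mp' mf.
  rewrite [X in measurable_fun _ X](_ : _ = fun t => K (fun k =>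
    (if k is k'.+1 then f k' else p \o p') t) (fun k => (g k \o p') t)); last first.
    by apply/funext => t; rewrite -(scons_fam (p \o p')).
  apply: (mK _ _ (fun k => if k is k'.+1 then f k' else p \o p')
    (fun k => g k \o p')); last by move=> k; exact: measurableT_comp.
  by apply: measurable_scons_fam => //; exact: measurableT_comp.
Qed.
End gauss_swap.

Section quadratic.
Context {R : realType}.

Definition rmeasurable (X : (nat -> R) -> R) : Prop :=
  forall (d' : measure_display) (T' : measurableType d')
    (f : nat -> T' -> R), (forall k, measurable_fun setT (f k)) ->
    measurable_fun setT (fun t => X (f ^~ t)).

Lemma rmeasurableE (X : (nat -> R) -> R) :
  rmeasurable X -> cmeasurable (fun w => (X w)%:E).
Proof. by move=> mX d' T' f mf; apply/measurable_EFinP; exact: mX. Qed.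

Lemma rmeasurable_sum_coord m (a : nat -> R) (j : nat -> nat) :
  rmeasurable (fun w => \sum_(k < m) a k * w (j k)).
Proof.
by move=> d' T' f mf; apply: measurable_sum => i; apply: measurable_funM.
Qed.

Lemma rmeasurable_sum_sqr r (L : nat -> (nat -> R) -> R) :
  (forall j, rmeasurable (L j)) ->
  rmeasurable (fun w => \sum_(j < r) L j w ^+ 2).
Proof.
move=> mL d' T' f mf; apply: measurable_sum => i; apply: measurable_funX.
exact: mL.
Qed.

Lemma rmeasurable_expR (X : (nat -> R) -> R) (c : R) :
  rmeasurable X -> rmeasurable (fun w => expR (c * X w)).
Proof.
move=> mX d' T' f mf; apply: measurableT_comp => //; apply: measurable_funM => //.
exact: mX.
Qed.

(* Hubbard-Stratonovich: the exponential of a square is a Gaussian average of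
   exponentials of linear forms, whose expectation is explicit. *)
Lemma gauss_iter_expR_quadratic (s B th : R) m r (A : nat -> nat -> R) :
  0 < s -> 0 <= th -> th * (s ^+ 2 * B) < 2^-1 ->
  (forall g : nat -> R, \sum_(k < m) (\sum_(j < r) A j k * g j) ^+ 2
     <= B * \sum_(j < r) g j ^+ 2) ->
  (gauss_iter s m (fun w =>
      (expR (th * \sum_(j < r) (\sum_(k < m) A j k * w k) ^+ 2))%:E) <=
   ((Num.sqrt (1 - 2 * (th * (s ^+ 2 * B))))^-1 ^+ r)%:E)%E.
Proof.
move=> s0 th0 thB AB.
(* With this [q], averaging over a standard Gaussian [g] turns the linear exponent into
   [q^2 / 2 = th] times the sum of squares. *)
pose q := Num.sqrt (2 * th).
have q2 : q ^+ 2 = 2 * th by rewrite sqr_sqrtr// mulr_ge0.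
pose K (w g : nat -> R) := expR (\sum_(j < r) (q * \sum_(k < m) A j k * w k) * g j).
rewrite (_ : (fun w => _) = (fun w => gauss_iter 1 r (fun g => (K w g)%:E))); last first.
  apply/funext => w; rewrite /K.
  rewrite (@gauss_iter_expR _ 1 r (fun j => q * \sum_(k < m) A j k * w k))//.
  congr ((expR _)%:E); rewrite expr1n mul1r.
  under [in RHS]eq_bigr do rewrite exprMn q2.
  by rewrite -mulr_sumr mulrAC [2 * th]mulrC mulfK.
rewrite (@gauss_iter_swap _ s 1 m r (fun w g => (K w g)%:E)); first last.
- move=> d T f g mf mg; apply/measurable_EFinP; apply: measurableT_comp => //.
  apply: measurable_sum => j; apply: measurable_funM => //.
  apply: measurable_funM => //; apply: measurable_sum => k.
  exact: measurable_funM.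
- by move=> w g; rewrite lee_fin expR_ge0.
(* Once the integrals are swapped, integrating over [w] produces the squared norm of the transpose
   of [A] applied to [g]; this is what the hypothesis on [B] bounds. *)
rewrite -gauss_iter_expR_sqr//; apply: le_gauss_iter => g.
  by apply: gauss_iter_ge0 => w; rewrite lee_fin expR_ge0.
rewrite (_ : (fun w => _) = (fun w : nat -> R => (expR (\sum_(k < m)
    (q * \sum_(j < r) A j k * g j) * w k))%:E)); last first.
  apply/funext => w; congr ((expR _)%:E).
  under eq_bigr do rewrite -mulrA mulr_suml mulr_sumr.
  rewrite exchange_big; apply: eq_bigr => k _ /=.
  rewrite -mulrA mulr_suml mulr_sumr; apply: eq_bigr => j _.
  by ring.
rewrite (@gauss_iter_expR _ s m (fun k => q * \sum_(j < r) A j k * g j))//.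
rewrite lee_fin ler_expR.
under eq_bigr do rewrite exprMn q2.
rewrite -mulr_sumr.
set S := \sum_(k < m) _; set G := \sum_(j < r) _.
rewrite (_ : s ^+ 2 * (2 * th * S) / 2 = th * s ^+ 2 * S); last by field.
rewrite (_ : th * (s ^+ 2 * B) * G = th * s ^+ 2 * (B * G)); last by ring.
by apply: ler_wpM2l; [rewrite mulr_ge0 ?sqr_ge0|exact: AB].
Qed.
End quadratic.

(** * Exceptional probabilities and Chernoff bounds *)

Section likely.
Context {R : realType}.
Implicit Types (s p : R) (m : nat) (P Q : (nat -> R) -> Prop).

(* [likely s m p P] : P fails with probability at most p, witnessed by a
   measurable majorant H of the indicator of the failure of P; P itself need
   not be measurable. *)
Definition likely s m p P : Prop := exists H : (nat -> R) -> R,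
  [/\ forall w, 0 <= H w, rmeasurable H,
      (gauss_iter s m (fun w => (H w)%:E) <= p%:E)%E
    & forall w, H w < 1 -> P w].

Lemma likely_sub s m p p' P P' : p <= p' -> (forall w, P w -> P' w) ->
  likely s m p P -> likely s m p' P'.
Proof.
move=> pp' PP' [H [H0 mH Hp HP]]; exists H; split=> //.
  by apply: le_trans Hp _; rewrite lee_fin.
by move=> w /HP; exact: PP'.
Qed.

Lemma likely_and s m p q P Q : likely s m p P -> likely s m q Q ->
  likely s m (p + q) (fun w => P w /\ Q w).
Proof.
move=> [H [H0 mH Hp HP]] [G [G0 mG Gq GQ]].
exists (fun w => H w + G w); split=> [w||| w HG].
- exact: addr_ge0.
- by move=> d' T' f mf; apply: measurable_funD; [exact: mH|exact: mG].
- have HE0 w : (0 <= (H w)%:E)%E by rewrite lee_fin.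
  have GE0 w : (0 <= (G w)%:E)%E by rewrite lee_fin.
  have := gauss_iterD s m HE0 GE0 (rmeasurableE mH) (rmeasurableE mG).
  by under [X in gauss_iter _ _ X = _]funext do rewrite -EFinD; move=> ->; rewrite EFinD leeD.
- by split; [apply: HP|apply: GQ]; have := H0 w; have := G0 w; lra.
Qed.

Lemma likely_all s m p (I : finType) (P : I -> (nat -> R) -> Prop) :
  (forall i, likely s m p (P i)) ->
  likely s m (#|I|%:R * p) (fun w => forall i, P i w).
Proof.
move=> /choice[H HP].
have H0 i w : 0 <= H i w by have [] := HP i.
exists (fun w => \sum_(i <- enum I) H i w); split=> [w||| w Hw i].
- by apply: sumr_ge0 => i _.
- by move=> d' T' f mf; apply: measurable_sum => i; have [_ mH _ _] := HP i; exact: mH.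
- under [X in gauss_iter _ _ X]funext do rewrite -sumEFin.
  rewrite (@gauss_iter_sum _ s m I (enum I) (fun i w => (H i w)%:E)).
  + apply: (@le_trans _ _ (\sum_(i <- enum I) p%:E)%E).
      by apply: lee_sum => i _; have [] := HP i.
    by rewrite sumEFin big_const_seq count_predT -cardE iter_addr_0 mulr_natl.
  + by move=> i w; rewrite lee_fin.
  + by move=> i; apply: rmeasurableE; have [] := HP i.
- have [_ _ _ HPi] := HP i; apply: HPi; apply: le_lt_trans Hw.
  rewrite big_enum (bigD1 i)//= lerDl.
  by apply: sumr_ge0.
Qed.

(** Conditioning tool: [F] may be a conditional probability that is at least [a] on the good event,
    and may fail to be measurable. *)
Lemma likely_gauss_iter s m p P (F : (nat -> R) -> \bar R) (a : R) :
  0 <= a <= 1 -> (forall w, 0 <= F w)%E -> likely s m p P ->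
  (forall w, P w -> a%:E <= F w)%E -> ((a - p)%:E <= gauss_iter s m F)%E.
Proof.
move=> /andP[a0 a1] F0 [H [H0 mH Hp HP]] PF.
apply: (gauss_iter_lb a0 F0 H0 (rmeasurableE mH)) => // w.
have [Hw|Hw] := ltP (H w) 1.
  apply: le_trans (PF w (HP w Hw)); rewrite lee_fin.
  by have := H0 w; lra.
by apply: le_trans (F0 w); rewrite lee_fin; lra.
Qed.

Lemma likely_prob s m p P (A : set (nat -> R)) : likely s m p P ->
  (forall w, P w -> A w) -> ((1 - p)%:E <= gauss_prob s m A)%E.
Proof.
move=> lP PA; apply: (likely_gauss_iter _ _ lP).
- by rewrite ler01 lexx.
- by move=> w; rewrite lee_fin indicE.
- by move=> w /PA Aw; rewrite lee_fin indicE mem_set.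
Qed.

Lemma likely_chernoff s m (X : (nat -> R) -> R) (c q t : R) : 0 < c ->
  rmeasurable X ->
  (gauss_iter s m (fun w => (expR (c * X w))%:E) <= q%:E)%E ->
  likely s m (q * expR (- (c * t))) (fun w => X w <= t).
Proof.
move=> c0 mX Xq; exists (fun w => expR (- (c * t)) * expR (c * X w)); split.
- by move=> w; rewrite mulr_ge0 ?expR_ge0.
- move=> d' T' f mf; apply: measurable_funM => //.
  exact: (rmeasurable_expR c mX).
- under [X in gauss_iter _ _ X]funext do rewrite EFinM.
  rewrite gauss_iterZl ?lee_fin ?expR_ge0//.
    by rewrite EFinM muleC lee_wpmul2r// lee_fin expR_ge0.
  exact/rmeasurableE/rmeasurable_expR.
- move=> w; rewrite -expRD -[ltRHS]expR0 ltr_expR => h.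
  by rewrite -(ler_pM2l c0); lra.
Qed.

Lemma likely_quadratic (del : R) : 0 < del -> exists2 c : R, 0 < c &
  forall (s B : R) m r (A : nat -> nat -> R), 0 < s -> 0 < B ->
  (forall g : nat -> R, \sum_(k < m) (\sum_(j < r) A j k * g j) ^+ 2
     <= B * \sum_(j < r) g j ^+ 2) ->
  likely s m (expR (- (c * r%:R))) (fun w =>
    \sum_(j < r) (\sum_(k < m) A j k * w k) ^+ 2 <= (1 + del) * (s ^+ 2 * B) * r%:R).
Proof.
move=> d0.
have d2 : 0 < 2 + del by lra.
exists (del ^+ 2 / (4 * (2 + del))).
  by rewrite divr_gt0 ?exprn_gt0 ?mulr_gt0.
move=> s B m r A s0 B0 AB.
(* Chosen so that [1 - 2 tau = 1 / (1 + del / 2)]. Each of the [r] factors is then at most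
   [expR (del / 4)], and [tau (1 + del) - del / 4] is exactly the rate [del^2 / (4 (2 + del))]. *)
pose tau := del / (2 * (2 + del)).
have tau0 : 0 < tau by rewrite divr_gt0 ?mulr_gt0.
have sB0 : 0 < s ^+ 2 * B by rewrite mulr_gt0 ?exprn_gt0.
pose th := tau / (s ^+ 2 * B).
have th0 : 0 < th by rewrite divr_gt0.
have thE : th * (s ^+ 2 * B) = tau by rewrite divfK ?gt_eqF.
have tauE : 1 - 2 * tau = (1 + del / 2)^-1.
  by rewrite /tau; field; rewrite !gt_eqF //; lra.
have tau2 : tau < 2^-1.
  have : 0 < 1 - 2 * tau by rewrite tauE invr_gt0; lra.
  lra.
have thB : th * (s ^+ 2 * B) < 2^-1 by rewrite thE.
have HQ := @gauss_iter_expR_quadratic _ s B th m r A s0 (ltW th0) thB AB.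
have mX : rmeasurable (fun w => \sum_(j < r) (\sum_(k < m) A j k * w k) ^+ 2).
  apply: (@rmeasurable_sum_sqr _ r (fun j w => \sum_(k < m) A j k * w k)) => j.
  exact: (rmeasurable_sum_coord m (A j) id).
have := likely_chernoff ((1 + del) * (s ^+ 2 * B) * r%:R) th0 mX HQ.
apply: likely_sub => //.
rewrite thE.
have qle : (Num.sqrt (1 - 2 * tau))^-1 <= expR (del / 4).
  rewrite tauE -sqrtrV ?invr_ge0; last by lra.
  rewrite invrK -[leRHS]ger0_norm ?expR_ge0// -sqrtr_sqr ler_sqrt ?exprn_ge0 ?expR_ge0//.
  rewrite -expRM_natl (_ : 2%:R * (del / 4) = del / 2); last by field.
  exact: expR_ge1Dx.
apply: (@le_trans _ _ (expR (del / 4) ^+ r * expR (- (th * ((1 + del) * (s ^+ 2 * B) * r%:R))))).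
  apply: ler_wpM2r; first exact: expR_ge0.
  by apply: lerXn2r; rewrite ?nnegrE ?invr_ge0 ?sqrtr_ge0 ?expR_ge0.
rewrite -expRM_natl -expRD ler_expR.
rewrite (_ : th * ((1 + del) * (s ^+ 2 * B) * r%:R) = th * (s ^+ 2 * B) * (1 + del) * r%:R); last by ring.
rewrite thE -mulNr -mulNr -[r%:R * _]mulrC -mulrDl -[leRHS]mulNr.
apply: ler_wpM2r => //.
rewrite le_eqVlt; apply/orP; left; apply/eqP.
by rewrite /tau; field; rewrite gt_eqF.
Qed.
End likely.

(** * Bounds for a fixed direction *)

Section vectors.
Context {R : realType}.

Lemma sum_sqr_ge0 (I : finType) (f : I -> R) : 0 <= \sum_i f i ^+ 2.
Proof. by apply: sumr_ge0 => i _; exact: sqr_ge0. Qed.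

Lemma cauchy_schwarz (I : finType) (f g : I -> R) :
  (\sum_i f i * g i) ^+ 2 <= (\sum_i f i ^+ 2) * (\sum_i g i ^+ 2).
Proof.
set A := \sum_i f i ^+ 2; set B := \sum_i g i ^+ 2; set C := \sum_i _.
have B0 : 0 <= B by exact: sum_sqr_ge0.
have HS : 0 <= B * (A * B - C ^+ 2).
  have := sum_sqr_ge0 (fun i => B * f i - C * g i).
  rewrite (eq_bigr (fun i => B ^+ 2 * f i ^+ 2 + - (2 * B * C) * (f i * g i)
    + C ^+ 2 * g i ^+ 2)); last by move=> i _; ring.
  rewrite !big_split /= -!mulr_sumr -/A -/B -/C.
  by rewrite (_ : _ + _ + _ = B * (A * B - C ^+ 2))//; ring.
have [B00|Bn0] := eqVneq B 0; last first.
  by move: HS; rewrite pmulr_rge0 ?subr_ge0// lt_neqAle eq_sym Bn0.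
have g0 i : g i = 0.
  apply/eqP; rewrite -sqrf_eq0; apply/eqP.
  have := B00; rewrite /B => /psumr_eq0P; apply => // j _; exact: sqr_ge0.
by rewrite B00 mulr0 /C big1 ?expr0n// => i _; rewrite g0 mulr0.
Qed.

Lemma dotv_ge0 d (x : 'I_d -> R) : 0 <= dotv x x.
Proof. by apply: sumr_ge0 => i _; rewrite -expr2; exact: sqr_ge0. Qed.

Lemma enorm_ge0 d (x : 'I_d -> R) : 0 <= enorm x.
Proof. exact: sqrtr_ge0. Qed.

Lemma enorm_sqr d (x : 'I_d -> R) : enorm x ^+ 2 = dotv x x.
Proof. by rewrite sqr_sqrtr// dotv_ge0. Qed.

Lemma dotv_sqr d (x : 'I_d -> R) : dotv x x = \sum_(k < d) x k ^+ 2.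
Proof. by apply: eq_bigr => k _; rewrite expr2. Qed.

Lemma dotv_eq0 d (x : 'I_d -> R) : dotv x x = 0 -> x = (fun _ => 0).
Proof.
rewrite dotv_sqr => /psumr_eq0P x0; apply/funext => k; apply/eqP.
by rewrite -sqrf_eq0; apply/eqP; apply: x0 => // j _; exact: sqr_ge0.
Qed.

Lemma dotvZr d (c : R) (x y : 'I_d -> R) :
  dotv x (fun k => c * y k) = c * dotv x y.
Proof. by rewrite /dotv mulr_sumr; apply: eq_bigr => k _; ring. Qed.

Lemma dotvZl d (c : R) (x y : 'I_d -> R) :
  dotv (fun k => c * x k) y = c * dotv x y.
Proof. by rewrite /dotv mulr_sumr; apply: eq_bigr => k _; ring. Qed.

Lemma unit_scale d (x : 'I_d -> R) : dotv x x <> 0 ->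
  exists y, [/\ dotv y y = 1 & x = (fun k => enorm x * y k)].
Proof.
move=> x0; have xp : 0 < enorm x.
  by rewrite sqrtr_gt0 lt_neqAle dotv_ge0 andbT eq_sym; apply/eqP.
exists (fun k => (enorm x)^-1 * x k); split.
  by rewrite dotvZl dotvZr -enorm_sqr; field; rewrite gt_eqF.
by apply/funext => k; rewrite mulVKf// gt_eqF.
Qed.

Lemma unit_coord d (x : 'I_d -> R) k : dotv x x = 1 -> `|x k| <= 1.
Proof.
rewrite dotv_sqr => x1; rewrite -(@ler_pXn2r _ 2%N) ?nnegrE// expr1n.
rewrite real_normK ?num_real// -x1 (bigD1 k)//= lerDl.
by apply: sumr_ge0 => i _; exact: sqr_ge0.
Qed.

Lemma sum_ord_mul n d (F : nat -> R) :
  \sum_(k < n * d) F k = \sum_(i < n) \sum_(l < d) F (i * d + l)%N.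
Proof.
elim: n F => [|n IH] F; first by rewrite mul0n !big_ord0.
rewrite mulSn big_split_ord big_ord_recl /=; congr (_ + _).
rewrite (IH (fun k => F (d + k)%N)); apply: eq_bigr => i _; apply: eq_bigr => l _.
by rewrite /bump /= add1n mulSn addnA.
Qed.

(** Padding by 0: the coefficients in [gauss_iter_linear] and in the quadratic bounds are indexed by
    naturals. *)
Definition ext d (x : 'I_d -> R) (k : nat) : R := oapp x 0 (insub k).

Lemma extE d (x : 'I_d -> R) (k : 'I_d) : ext x k = x k.
Proof. by rewrite /ext valK. Qed.

Lemma gauss_iter_expR_dotv (s c : R) d (Y : 'I_d -> R) : 0 < s ->
  dotv Y Y = 1 ->
  gauss_iter s d (fun w => (expR (c * (s^-1 * dotv (fun k : 'I_d => w k) Y)))%:E) =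
  (expR (c ^+ 2 / 2))%:E.
Proof.
move=> s0 Y1.
rewrite (_ : (fun w => _) = (fun w : nat -> R =>
  (expR (\sum_(k < d) (c * s^-1 * ext Y k) * w k))%:E)); last first.
  apply/funext => w; congr ((expR _)%:E); rewrite /dotv mulrA mulr_sumr.
  by apply: eq_bigr => k _; rewrite extE; ring.
rewrite (gauss_iter_expR _ (fun k => c * s^-1 * ext Y k) s0); congr ((expR _)%:E).
rewrite (eq_bigr (fun k : 'I_d => (c * s^-1) ^+ 2 * Y k ^+ 2)); last first.
  by move=> k _; rewrite extE exprMn.
by rewrite -mulr_sumr -dotv_sqr Y1; field; rewrite gt_eqF.
Qed.

Lemma gauss_iter_coord (s c : R) m j : 0 < s -> (j < m)%N ->
  gauss_iter s m (fun w => (expR (c * w j))%:E) = (expR (s ^+ 2 * c ^+ 2 / 2))%:E.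
Proof.
move=> s0 jm.
have sumE (F : nat -> R) : \sum_(k < m) (k == j :> nat)%:R * F k = F j.
  rewrite (bigD1 (Ordinal jm))//= eqxx mul1r big1 ?addr0// => k /negbTE kj.
  by rewrite -val_eqE /= in kj; rewrite kj mul0r.
rewrite (_ : (fun w => _) = (fun w : nat -> R =>
  (expR (\sum_(k < m) (c * (k == j :> nat)%:R) * w k))%:E)); last first.
  apply/funext => w; rewrite (eq_bigr (fun k : 'I_m => (k == j :> nat)%:R * (c * w k))).
    by rewrite (sumE (fun k => c * w k)).
  by move=> k _; ring.
have sum2 : \sum_(k < m) (c * (k == j :> nat)%:R) ^+ 2 = c ^+ 2.
  rewrite (eq_bigr (fun k : 'I_m => (k == j :> nat)%:R * c ^+ 2)).
    by rewrite (sumE (fun=> c ^+ 2)).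
  by move=> k _; case: eqP => _; rewrite ?mulr1 ?mul1r ?mulr0 ?mul0r ?expr0n.
have := @gauss_iter_expR R s m (fun k => c * (k == j)%:R) s0.
by rewrite sum2.
Qed.

(** Two one-sided Chernoff bounds. With [s^2 = 1/d] and [c = d] the failure probability is
    [2 expR (- d / 2)]. *)
Lemma likely_coord (s c : R) m j : 0 < s -> 0 < c -> (j < m)%N ->
  likely s m (2 * expR (s ^+ 2 * c ^+ 2 / 2 - c)) (fun w => `|w j| <= 1).
Proof.
move=> s0 c0 jm.
have mw (e : R) : rmeasurable (fun w => e * w j).
  by move=> d' T' f mf; apply: measurable_funM.
have h (e : R) : e ^+ 2 = 1 ->
   likely s m (expR (s ^+ 2 * c ^+ 2 / 2 - c)) (fun w => e * w j <= 1).
  move=> e2; have := @likely_chernoff _ s m _ c (expR (s ^+ 2 * c ^+ 2 / 2)) 1 c0 (mw e).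
  rewrite mulr1 -expRD; apply.
  have := gauss_iter_coord (c * e) s0 jm.
  have -> : (fun w : nat -> R => (expR (c * e * w j))%:E) =
      (fun w => (expR (c * (e * w j)))%:E).
    by apply/funext => w; rewrite mulrA.
  by move=> ->; rewrite exprMn e2 mulr1.
have N1 : (- 1) ^+ 2 = 1 :> R by rewrite sqrrN expr1n.
have := likely_and (h 1 (expr1n _ _)) (h (- 1) N1).
apply: likely_sub; first by rewrite mulr2n mulrDl mul1r.
by move=> w []; rewrite mul1r mulN1r ler_norml => -> ?; rewrite andbT lerNl.
Qed.

(** The cube is cut into cells of side [1/N], and the net takes one unit vector from each cell that
    contains any. Grid points would not have norm 1, which the fixed-direction bounds require. Cells
    without unit vectors get the default [e0]. *)
Lemma unit_net d N : (0 < d)%N -> (0 < N)%N ->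
  exists Y : {ffun 'I_d -> 'I_(2 * N).+1} -> 'I_d -> R,
    (forall g, dotv (Y g) (Y g) = 1) /\
    (forall x, dotv x x = 1 -> exists g, forall k, `|x k - Y g k| <= N%:R^-1).
Proof.
move=> d0 N0; have Np : 0 < N%:R :> R by rewrite ltr0n.
pose e0 (k : 'I_d) : R := (k == Ordinal d0)%:R.
have e01 : dotv e0 e0 = 1.
  rewrite /dotv (bigD1 (Ordinal d0))//= /e0 eqxx mulr1 big1 ?addr0// => k /negbTE ->.
  by rewrite mul0r.
pose tr (x : 'I_d -> R) k := Num.truncn ((x k + 1) * N%:R).
pose cell x : {ffun 'I_d -> 'I_(2 * N).+1} := [ffun k => inord (tr x k)].
pose Y g := xget e0 [set x | dotv x x = 1 /\ cell x = g].
have tr_itv x k : dotv x x = 1 ->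
    (tr x k)%:R <= (x k + 1) * N%:R < (tr x k).+1%:R /\ (tr x k < (2 * N).+1)%N.
  move=> x1; have := unit_coord k x1; rewrite ler_norml => /andP[xl xr].
  have ge0 : 0 <= (x k + 1) * N%:R by apply: mulr_ge0; [lra|exact: ltW].
  have itv := truncn_itv ge0; split=> //.
  rewrite ltnS -(@ler_nat R); case/andP: itv => h _; apply: le_trans h _.
  by rewrite natrM; apply: ler_wpM2r; [exact: ltW|lra].
exists Y; split => [g|x x1].
  rewrite /Y; case: xgetP => [y -> []//|_]; exact: e01.
exists (cell x) => k.
have [Y1 Yc] : dotv (Y (cell x)) (Y (cell x)) = 1 /\ cell (Y (cell x)) = cell x.
  by rewrite /Y; case: xgetP => [y -> //|/(_ x)] /not_andP; case.
have /(congr1 (fun g : {ffun _} => nat_of_ord (g k))) := Yc.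
rewrite !ffunE.
have [/andP[a1 a2] a3] := tr_itv _ k x1.
have [/andP[b1 b2] b3] := tr_itv _ k Y1.
rewrite !inordK// => trE; rewrite trE in b1 b2.
rewrite -(ler_pM2r Np) mulVf ?gt_eqF// -{1}(ger0_norm (ltW Np)) -normrM.
rewrite -natr1 in a2 b2.
rewrite ler_norml; apply/andP; split; nra.
Qed.

(** The net has at most [expR (d (2 ln d + 2))] points, so [E >= d (2 ln d + 4)] leaves
    [expR (- 2 d)]. The event holds at a neighbour [Y] of [x]; passing from [Y] to [x] is left to
    each application. *)
Lemma likely_net d m (s E : R) (P : ('I_d -> R) -> (nat -> R) -> Prop) :
  (0 < d)%N -> d%:R * (2 * ln d%:R + 4) <= E ->
  (forall Y, dotv Y Y = 1 -> likely s m (expR (- E)) (P Y)) ->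
  likely s m (expR (- (2 * d%:R))) (fun w => forall x, dotv x x = 1 ->
    exists Y, [/\ dotv Y Y = 1, forall k, `|x k - Y k| <= (d%:R ^+ 2)^-1 & P Y w]).
Proof.
move=> d0 dE HP; have d2 : (0 < d ^ 2)%N by rewrite expn_gt0 d0.
have dp : 0 < d%:R :> R by rewrite ltr0n.
have [Y [Y1 Ynet]] := unit_net d0 d2.
have := likely_all (fun g => HP (Y g) (Y1 g)).
apply: likely_sub; last first.
  move=> w HY x x1; have [g xg] := Ynet x x1; exists (Y g); split => //.
  by move=> k; rewrite -natrX.
rewrite card_ffun !card_ord.
have e1 : (2 * d ^ 2).+1%:R <= expR (2 + 2 * ln d%:R) :> R.
  rewrite expRD expRM_natl lnK ?posrE// -natr1 natrM natrX.
  apply: (@le_trans _ _ (3 * d%:R ^+ 2)).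
    have : 1 <= d%:R :> R by rewrite ler1n.
    nra.
  apply: ler_wpM2r; first exact: sqr_ge0.
  by have := expR_ge1Dx (2 : R); lra.
rewrite natrX; apply: (@le_trans _ _ (expR (2 + 2 * ln d%:R) ^+ d * expR (- E))).
  by apply: ler_wpM2r; [exact: expR_ge0|apply: lerXn2r; rewrite ?nnegrE ?expR_ge0].
rewrite -expRM_natl -expRD ler_expR; lra.
Qed.
End vectors.

(** * Lower tail of a Gaussian maximum *)

Section tilt.
Context {R : realType}.
Implicit Types t x s : R.

(* A combination of exponentials dominating the indicator of [x < t], with
   Gaussian mean below 1 by about the Gaussian tail at t: tilting by
   [expR ((t + 2) * x)] centres the Gaussian at t + 2, and the two other terms
   compensate it outside [t, t + 4]. *)
Definition tilt t x : R := 1 + expR (- ((t + 2) * (t + 4))) *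
  (expR (2 * t) * expR (t * x) + expR (- (2 * (t + 4))) * expR ((t + 4) * x)
   - expR ((t + 2) * x)).

Lemma tilt_ge1 t x : x < t -> 1 <= tilt t x.
Proof.
move=> xt; rewrite /tilt lerDl mulr_ge0 ?expR_ge0// -!expRD subr_ge0.
apply: (@le_trans _ _ (expR (2 * t + t * x))); last by rewrite lerDl expR_ge0.
by rewrite ler_expR; lra.
Qed.

(** Beyond [t + 4] the second exponential outweighs the subtracted one; below it, the prefactor
    makes the subtracted term at most 1. *)
Lemma tilt_ge0 t x : 0 <= t -> 0 <= tilt t x.
Proof.
move=> t0; have [xT|xT] := leP x (t + 4); last first.
  rewrite /tilt addr_ge0// mulr_ge0 ?expR_ge0// -!expRD subr_ge0.
  apply: (@le_trans _ _ (expR (- (2 * (t + 4)) + (t + 4) * x))); last by rewrite lerDr expR_ge0.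
  by rewrite ler_expR; lra.
rewrite /tilt mulrBr addrCA addr_ge0//.
rewrite -expRD subr_ge0 -[leRHS]expR0 ler_expR.
have : (t + 2) * x <= (t + 2) * (t + 4) by apply: ler_wpM2l => //; lra.
lra.
Qed.

(** With [p] the exponential here, [tilt t] has Gaussian mean [1 - p + 2 expR (-2) p];
    [expR (-2) <= 1/4] bounds it by [1 - p / 2]. The exponent is [t^2 / 2 + 4 t + 6], the true
    Gaussian rate to leading order. *)
Definition gtail t : R := expR (- ((t + 2) ^+ 2 / 2 + 2 * (t + 2))) / 2.

Lemma gauss_iter_tilt s d (Y : 'I_d -> R) t : 0 < s -> 0 <= t ->
  dotv Y Y = 1 ->
  (gauss_iter s d (fun w => (tilt t (s^-1 * dotv (fun k : 'I_d => w k) Y))%:E)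
   <= (expR (- gtail t))%:E)%E.
Proof.
move=> s0 t0 Y1.
pose X (w : nat -> R) := s^-1 * dotv (fun k : 'I_d => w k) Y.
have mX : rmeasurable X.
  move=> d' T' f mf; apply: measurable_funM => //.
  by apply: measurable_sum => k; apply: measurable_funM.
pose D := expR (- ((t + 2) * (t + 4))).
have mE c := rmeasurable_expR c mX.
have mt : rmeasurable (fun w => tilt t (X w)).
  move=> d' T' f mf; apply: measurable_funD => //; apply: measurable_funM => //.
  apply: measurable_funB; last exact: mE.
  by apply: measurable_funD; apply: measurable_funM => //; exact: mE.
have E0 c w : (0 <= (expR (c * X w))%:E)%E by rewrite lee_fin expR_ge0.
have EE c : gauss_iter s d (fun w => (expR (c * X w))%:E) = (expR (c ^+ 2 / 2))%:E.
  exact: gauss_iter_expR_dotv.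
have EZ a c : 0 <= a ->
    gauss_iter s d (fun w => (a%:E * (expR (c * X w))%:E)%E) = (a * expR (c ^+ 2 / 2))%:E.
  move=> a0; rewrite gauss_iterZl ?lee_fin//.
    by rewrite EE EFinM.
  exact/rmeasurableE.
have mEZ a c : rmeasurable (fun w => a * expR (c * X w)).
  by move=> d' T' f mf; apply: measurable_funM => //; exact: mE.
(* [gauss_iterD] handles nonnegative functions only, so the subtracted exponential of [tilt] is
   moved to the left-hand side. *)
have key : (gauss_iter s d (fun w => (tilt t (X w))%:E) +
    (D * expR ((t + 2) ^+ 2 / 2))%:E = (1 + D * expR (2 * t) * expR (t ^+ 2 / 2) +
      D * expR (- (2 * (t + 4))) * expR ((t + 4) ^+ 2 / 2))%:E)%E.
  have a1 : 0 <= D by exact: expR_ge0.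
  have a2 : 0 <= D * expR (2 * t) by rewrite mulr_ge0 ?expR_ge0.
  have a3 : 0 <= D * expR (- (2 * (t + 4))) by rewrite mulr_ge0 ?expR_ge0.
  rewrite -(EZ _ _ a1) -gauss_iterD; first last.
  - exact: (rmeasurableE (mEZ D (t + 2))).
  - exact: rmeasurableE.
  - by move=> w; rewrite -EFinM lee_fin mulr_ge0 ?expR_ge0.
  - by move=> w; rewrite lee_fin tilt_ge0.
  rewrite !EFinD -(EZ _ _ a2) -(EZ _ _ a3) -[X in (X + _ + _)%E](gauss_iter_cst s d).
  rewrite -gauss_iterD; first last.
  - exact: (rmeasurableE (mEZ _ t)).
  - by move=> d' T' f mf; exact: measurable_cst.
  - by move=> w; rewrite -EFinM lee_fin mulr_ge0 ?expR_ge0.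
  - by move=> w.
  rewrite -gauss_iterD; first last.
  - exact: (rmeasurableE (mEZ _ (t + 4))).
  - move=> d' T' f mf; apply: emeasurable_funD; first exact: measurable_cst.
    exact: (rmeasurableE (mEZ _ t)).
  - by move=> w; rewrite -EFinM lee_fin mulr_ge0 ?expR_ge0.
  - by move=> w; rewrite -EFinM -EFinD lee_fin addr_ge0// mulr_ge0 ?expR_ge0.
  congr gauss_iter; apply/funext => w; rewrite -!EFinM -!EFinD; congr (_%:E).
  by rewrite /tilt -/D; ring.
have : (gauss_iter s d (fun w => (tilt t (X w))%:E) <= (1 + D * expR (2 * t) * expR (t ^+ 2 / 2) +
      D * expR (- (2 * (t + 4))) * expR ((t + 4) ^+ 2 / 2) - D * expR ((t + 2) ^+ 2 / 2))%:E)%E.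
  by rewrite EFinB leeBrDr// key.
move=> /le_trans; apply; rewrite lee_fin.
rewrite /D -!expRD.
pose p := expR (- ((t + 2) ^+ 2 / 2 + 2 * (t + 2))).
rewrite (_ : - ((t + 2) * (t + 4)) + 2 * t + t ^+ 2 / 2 =
   - ((t + 2) ^+ 2 / 2 + 2 * (t + 2)) + - 2); last by field.
rewrite (_ : - ((t + 2) * (t + 4)) - 2 * (t + 4) + (t + 4) ^+ 2 / 2 =
   - ((t + 2) ^+ 2 / 2 + 2 * (t + 2)) + - 2); last by field.
rewrite (_ : - ((t + 2) * (t + 4)) + (t + 2) ^+ 2 / 2 =
   - ((t + 2) ^+ 2 / 2 + 2 * (t + 2))); last by field.
rewrite expRD -/p.
apply: (@le_trans _ _ (1 + - gtail t)); last exact: expR_ge1Dx.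
rewrite /gtail -/p.
have p0 : 0 < p by exact: expR_gt0.
have e4 : expR (- 2) <= 4^-1 :> R.
  rewrite expRN lef_pV2 ?posrE ?expR_gt0//.
  have := expR_ge1Dx (1 : R); rewrite (_ : 2 = 1 + 1 :> R) // expRD.
  have := expR_gt0 (1 : R); nra.
nra.
Qed.

(** If the first [n'] scalar products all lie below [s * t], every factor [tilt] is at least 1, and
    so is their product; its mean factorises over the independent blocks. The blocks from [n'] on
    contribute the factor 1. *)
Lemma likely_exists_large s d n n' (Y : 'I_d -> R) t : 0 < s -> 0 <= t ->
  (n' <= n)%N -> dotv Y Y = 1 ->
  likely s (n * d) (expR (- (gtail t * n'%:R))) (fun w =>
    exists2 i : 'I_n, (i < n')%N & s * t <= dotv (vecs n d 0 w i) Y).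
Proof.
move=> s0 t0 n'n Y1.
pose f (i : nat) (v : 'I_d -> R) := if (i < n')%N then tilt t (s^-1 * dotv v Y) else 1.
have f0 i v : 0 <= f i v by rewrite /f; case: ifP => // _; exact: tilt_ge0.
have mf i : vmeasurable (f i).
  move=> d' T' g mg; rewrite /f; case: (i < n')%N; last exact: measurable_cst.
  have mX : measurable_fun setT (fun t' : T' => s^-1 * dotv (g^~ t') Y).
    apply: measurable_funM => //.
    by apply: measurable_sum => k; apply: measurable_funM.
  have mE c : measurable_fun setT (fun t' : T' => expR (c * (s^-1 * dotv (g^~ t') Y))).
    by apply: measurableT_comp => //; apply: measurable_funM.
  apply: measurable_funD => //; apply: measurable_funM => //.
  apply: measurable_funB; last exact: mE.
  by apply: measurable_funD; apply: measurable_funM.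
pose p (i : nat) := if (i < n')%N then expR (- gtail t) else 1 : R.
exists (fun w => \prod_(i < n) f i (fun k => w (i * d + k)%N)); split.
- by move=> w; apply: prodr_ge0 => i _; exact: f0.
- move=> d' T' g mg; apply: measurable_prod => i _.
  exact: (mf i d' T' (fun k => g (i * d + k)%N) (fun k => mg _)).
- have -> : expR (- (gtail t * n'%:R)) = \prod_(i < n) p i.
    rewrite -mulNr mulrC expRM_natl -big_mkcond /=.
    by rewrite -(big_ord_widen n (fun=> expR (- gtail t)) n'n) prodr_const card_ord.
  apply: gauss_iter_blocks => // i _; rewrite /f /p; case: ifP => _.
    exact: gauss_iter_tilt.
  by rewrite gauss_iter_cst.
- move=> w; rewrite ltNge; apply: contraNP => /forall2NP Hn.
  apply: (big_ind (fun x => 1 <= x)) => //; first exact: mulr_ege1.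
  move=> i _; rewrite /f; case: ifP => // ilt; apply: tilt_ge1.
  have [/(_ ilt)//|/negP] := Hn i; rewrite -ltNge => h.
  by rewrite mulrC ltr_pdivrMr// mulrC.
Qed.
End tilt.

(** * Growth comparisons for the union bounds *)

Section asymptotics.
Context {R : realType}.

Lemma eventually_ln (M : R) : exists d0 : nat, forall d : nat, (d0 <= d)%N ->
  (0 < d)%N /\ M <= ln d%:R.
Proof.
exists (Num.truncn (expR M)).+1 => d dd0.
have d0 : (0 < d)%N by exact: leq_trans dd0.
have /andP[_ h] := truncn_itv (expR_ge0 M); split=> //.
rewrite -[leLHS]expRK ler_ln ?posrE ?expR_gt0 ?ltr0n//.
by apply: le_trans (ltW h) _; rewrite ler_nat.
Qed.

Lemma expR_ge_cube (x : R) : 0 <= x -> x ^+ 3 / 27 <= expR x.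
Proof.
move=> x0; rewrite [x in expR x](_ : x = 3%:R * (x / 3)); last by field.
rewrite expRM_natl (_ : x ^+ 3 / 27 = (x / 3) ^+ 3); last by field.
apply: lerXn2r; rewrite ?nnegrE ?expR_ge0//; first by rewrite divr_ge0.
by have := expR_ge1Dx (x / 3); lra.
Qed.

Lemma net_asymp (a : R) : 0 < a -> exists M : R, forall (d : nat) (x : R),
  (0 < d)%N -> M <= ln d%:R -> a * d%:R ^+ 2 / ln d%:R <= x ->
  d%:R * (2 * ln d%:R + 4) <= x.
Proof.
(* With [L = ln d], the claim is [L (2 L + 4) <= a d]. Here [d >= L^3 / 27] and [2 L + 4 <= 6 L],
   hence the constant [162 = 27 * 6]. *)
move=> a0; exists (1 + 162 / a) => d x d0 ML; apply: le_trans.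
have dp : 0 < d%:R :> R by rewrite ltr0n.
have /expR_ge_cube : 0 <= ln d%:R :> R.
  by apply: le_trans ML; rewrite addr_ge0// divr_ge0// ltW.
rewrite lnK ?posrE//; set L := ln d%:R in ML * => dL.
have L1 : 1 <= L by apply: le_trans ML; rewrite lerDl divr_ge0// ltW.
have La : 162 <= a * L.
  by rewrite mulrC -ler_pdivrMr//; apply: le_trans ML; rewrite lerDr.
have L0 : 0 < L by lra.
rewrite ler_pdivlMr// expr2.
rewrite (_ : a * (d%:R * d%:R) = d%:R * (a * d%:R)); last by ring.
rewrite -mulrA ler_pM2l//.
have h1 : a * (L ^+ 3 / 27) <= a * d%:R by apply: ler_wpM2l => //; exact: ltW.
apply: le_trans h1.
have h2 : 162 * L ^+ 2 <= a * L * L ^+ 2.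
  by apply: ler_wpM2r => //; exact: sqr_ge0.
rewrite (_ : a * (L ^+ 3 / 27) = a * L * L ^+ 2 / 27); last by field.
nra.
Qed.

(** With [t = (1 - del) sqrt (2 L)], [t^2 / 2 <= (1 - del) L] leaves an exponent of [del L]. The
    lower-order [4 t] eats at most half of it, and [expR (del L / 2)] still beats any power of
    [L]. *)
Lemma gtail_asymp (a del : R) : 0 < a -> 0 < del -> del <= 1 ->
  exists M : R, forall L : R, M <= L ->
  L * (2 * L + 4) <= a * expR L * gtail ((1 - del) * Num.sqrt (2 * L)).
Proof.
move=> a0 del0 del1.
have e6 : 0 < expR 6 :> R by exact: expR_gt0.
have ad : 0 < a * del ^+ 3 by rewrite mulr_gt0 ?exprn_gt0.
have q1 : 0 <= 128 / del ^+ 2 by rewrite divr_ge0// sqr_ge0.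
(* [432 = 8 * 27 * 2] gathers the cube of [1/2], the 27 of [expR_ge_cube] and the 2 of [gtail]; the
   6 in [K] comes from [2 L + 4 <= 6 L]. *)
have [J JE] : exists J : R, J = 432 by exists 432.
have [K KE] : exists K : R, K = 6 * J by exists (6 * J).
have J0 : 0 < J by lra.
have K0 : 0 < K by lra.
have q2 : 0 <= K * expR 6 / (a * del ^+ 3).
  by rewrite divr_ge0 ?mulr_ge0// ltW.
exists (1 + 128 / del ^+ 2 + K * expR 6 / (a * del ^+ 3)) => L ML.
have L1 : 1 <= L by lra.
have L128 : 128 <= L * del ^+ 2 by rewrite -ler_pdivrMr ?exprn_gt0//; lra.
have LK : K * expR 6 <= L * (a * del ^+ 3) by rewrite -ler_pdivrMr//; lra.
set q := Num.sqrt (2 * L).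
have q0 : 0 <= q by exact: sqrtr_ge0.
have qq : q ^+ 2 = 2 * L by rewrite sqr_sqrtr//; lra.
have qle : 8 * q <= del * L.
  rewrite -(@ler_pXn2r _ 2%N) ?nnegrE ?mulr_ge0//; [|exact: ltW|lra].
  rewrite !exprMn qq.
  have : 128 * L <= L * del ^+ 2 * L by apply: ler_wpM2r; lra.
  lra.
set t := (1 - del) * q.
have tq : t <= q by rewrite /t -[leRHS]mul1r; apply: ler_wpM2r => //; lra.
have t2 : t ^+ 2 <= (1 - del) * (2 * L).
  by rewrite /t exprMn qq; apply: ler_wpM2r; [lra|nra].
have ex : del * L / 2 - 6 <= L - ((t + 2) ^+ 2 / 2 + 2 * (t + 2)).
  rewrite (_ : (t + 2) ^+ 2 / 2 + 2 * (t + 2) = t ^+ 2 / 2 + 4 * t + 6); last by field.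
  lra.
have h : expR (del * L / 2) / expR 6 / 2 <= expR L * gtail t.
  by rewrite /gtail mulrA -!expRD -expRN -expRD ler_pM2r// ler_expR.
have dL0 : 0 <= del * L / 2 by rewrite divr_ge0// mulr_ge0 ?ltW//; lra.
have cube := expR_ge_cube dL0.
rewrite -mulrA; apply: (@le_trans _ _ (a * (((del * L / 2) ^+ 3 / 27) / expR 6 / 2))).
  rewrite [leRHS](_ : _ = L * (a * del ^+ 3) * L ^+ 2 / expR 6 / J); last first.
    by rewrite JE; field; rewrite gt_eqF.
  apply: (@le_trans _ _ (K * expR 6 * L ^+ 2 / expR 6 / J)).
    rewrite [leRHS](_ : _ = 6 * L ^+ 2); last by rewrite KE; field; rewrite !gt_eqF.
    nra.
  rewrite ler_pM2r ?invr_gt0// ler_pM2r ?invr_gt0//.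
  by apply: ler_wpM2r => //; exact: sqr_ge0.
apply: ler_wpM2l; first exact: ltW.
apply: le_trans h; rewrite ler_pM2r// ler_pM2r ?invr_gt0//.
Qed.
End asymptotics.

(** * Concentration of sums over blocks *)

Section block_sums.
Context {R : realType}.

Lemma sum_delta n (i : nat) (F : nat -> R) : (i < n)%N ->
  \sum_(j < n) (j == i :> nat)%:R * F j = F i.
Proof.
move=> lt_in; rewrite (bigD1 (Ordinal lt_in))//= eqxx mul1r big1 ?addr0// => k.
by rewrite -val_eqE /= => /negbTE ->; rewrite mul0r.
Qed.

Lemma divmod_ord (d i : nat) (l : 'I_d) :
  (((i * d + l) %/ d)%N = i) * (((i * d + l) %% d)%N = l).
Proof.
have d0 : (0 < d)%N by exact: leq_ltn_trans (ltn_ord l).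
by rewrite divnMDl// divn_small// addn0 modnMDl modn_small.
Qed.

Lemma sd_sqr (d : nat) : sd_of R d ^+ 2 = d%:R^-1.
Proof. by rewrite /sd_of exprVn sqr_sqrtr. Qed.

Lemma sd_gt0 (d : nat) : (0 < d)%N -> 0 < sd_of R d.
Proof. by move=> d0; rewrite invr_gt0 sqrtr_gt0 ltr0n. Qed.

(** Row [j] of [A] carries [Y] in block [j] and 0 elsewhere. The rows are orthonormal, so
    [likely_quadratic] applies with [B = 1]. *)
Lemma likely_sum_sqr_dotv (del : R) : 0 < del -> exists2 c : R, 0 < c &
  forall (s : R) (n d : nat) (Y : 'I_d -> R), 0 < s -> dotv Y Y = 1 ->
  likely s (n * d) (expR (- (c * n%:R))) (fun w =>
    \sum_(i < n) dotv (vecs n d 0 w i) Y ^+ 2 <= (1 + del) * s ^+ 2 * n%:R).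
Proof.
move=> del0; have [c c0 Hc] := likely_quadratic del0; exists c => //.
move=> s n d Y s0 Y1.
pose A (j q : nat) := (j == q %/ d)%N%:R * ext Y (q %% d).
have := Hc s 1 (n * d)%N n A s0 ltr01.
have hyp (g : nat -> R) : \sum_(k < n * d) (\sum_(j < n) A j k * g j) ^+ 2 <=
    1 * \sum_(j < n) g j ^+ 2.
  rewrite mul1r (sum_ord_mul n d (fun k => (\sum_(j < n) A j k * g j) ^+ 2)).
  apply: ler_sum => i _.
  rewrite (eq_bigr (fun l : 'I_d => g i ^+ 2 * Y l ^+ 2)); last first.
    move=> l _; rewrite (eq_bigr (fun j : 'I_n => (j == i :> nat)%:R * (Y l * g j))).
      by rewrite (sum_delta (fun j => Y l * g j))// exprMn mulrC.
    by move=> j _; rewrite /A !divmod_ord extE mulrA.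
  by rewrite -mulr_sumr -dotv_sqr Y1 mulr1.
move=> /(_ hyp); apply: likely_sub => // w.
rewrite mulr1; congr (_ <= _); apply: eq_bigr => j _; congr (_ ^+ 2).
rewrite (sum_ord_mul n d (fun k => A j k * w k)).
rewrite (eq_bigr (fun i : 'I_n => (i == j :> nat)%:R * \sum_(l < d) (w (i * d + l)%N * Y l))).
  by rewrite (sum_delta (fun i => \sum_(l < d) (w (i * d + l)%N * Y l))).
move=> i _; rewrite mulr_sumr; apply: eq_bigr => l _.
by rewrite /A !divmod_ord extE eq_sym -mulrA; congr (_ * _); rewrite mulrC.
Qed.

(** The matrix is a linear image of the Gaussian family under the Kronecker product of the transpose
    of [a] with the identity, with the pair [(k, l)] coded as [k * d + l]. This product has the
    operator norm of [a]. *)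
Lemma likely_frobenius (del : R) : 0 < del -> exists2 c : R, 0 < c &
  forall (s B : R) (n d : nat) (a : nat -> nat -> R), 0 < s -> 0 < B ->
  (forall x : nat -> R, \sum_(i < n) (\sum_(k < d) a i k * x k) ^+ 2 <=
      B * \sum_(k < d) x k ^+ 2) ->
  likely s (n * d) (expR (- (c * (d * d)%:R))) (fun w =>
    \sum_(k < d) \sum_(l < d) (\sum_(i < n) a i k * w (i * d + l)%N) ^+ 2
      <= (1 + del) * (s ^+ 2 * B) * (d * d)%:R).
Proof.
move=> del0; have [c c0 Hc] := likely_quadratic del0; exists c => //.
move=> s B n d a s0 B0 aB.
pose A (j q : nat) := a (q %/ d)%N (j %/ d)%N * (j %% d == q %% d)%N%:R.
have := Hc s B (n * d)%N (d * d)%N A s0 B0.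
have hyp (g : nat -> R) : \sum_(k < n * d) (\sum_(j < d * d) A j k * g j) ^+ 2 <=
    B * \sum_(j < d * d) g j ^+ 2.
  rewrite (sum_ord_mul n d (fun k => (\sum_(j < d * d) A j k * g j) ^+ 2)).
  rewrite (sum_ord_mul d d (fun j => g j ^+ 2)).
  rewrite (eq_bigr (fun i : 'I_n => \sum_(l < d)
      (\sum_(k < d) a i k * g (k * d + l)%N) ^+ 2)); last first.
    move=> i _; apply: eq_bigr => l _; congr (_ ^+ 2).
    rewrite (sum_ord_mul d d (fun j => A j (i * d + l)%N * g j)).
    apply: eq_bigr => k _.
    rewrite (eq_bigr (fun l' : 'I_d => (l' == l :> nat)%:R * (a i k * g (k * d + l')%N))).
      by rewrite (sum_delta (fun l' => a i k * g (k * d + l')%N)).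
    by move=> l' _; rewrite /A !divmod_ord; ring.
  rewrite exchange_big [X in B * X]exchange_big mulr_sumr.
  by apply: ler_sum => l _; exact: (aB (fun k => g (k * d + l)%N)).
move=> /(_ hyp); apply: likely_sub => // w.
rewrite (sum_ord_mul d d (fun j => (\sum_(k < n * d) A j k * w k) ^+ 2)).
congr (_ <= _); apply: eq_bigr => k _; apply: eq_bigr => l _; congr (_ ^+ 2).
rewrite (sum_ord_mul n d (fun q => A (k * d + l)%N q * w q)).
apply: eq_bigr => i _.
rewrite (eq_bigr (fun l' : 'I_d => (l' == l :> nat)%:R * (a i k * w (i * d + l')%N))).
  by rewrite (sum_delta (fun l' => a i k * w (i * d + l')%N)).
by move=> l' _; rewrite /A !divmod_ord eq_sym; ring.
Qed.

Lemma likely_sum_abs_dotv (del : R) : 0 < del -> del < 1 -> exists2 c : R, 0 < c &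
  forall (s : R) (n d : nat) (Y : 'I_d -> R), 0 < s -> dotv Y Y = 1 ->
  likely s (n * d) (expR (- (c * n%:R))) (fun w =>
    (1 - del) * (2 * normal_peak 1) * s * n%:R <=
    \sum_(i < n) `|dotv (vecs n d 0 w i) Y|).
Proof.
move=> del0 del1; have Habs := @integral_normal_expR_abs R.
have kap0 : 0 < 2 * normal_peak (1 : R) by rewrite mulr_gt0 ?normal_peak_gt0 ?oner_neq0.
set kap := 2 * normal_peak (1 : R) in Habs kap0 *; clearbody kap.
(* Minimises the exponent [- l del kap + 6 l^2], with value [- del^2 kap^2 / 24]. *)
pose l := del * kap / 12.
have l0 : 0 < l by rewrite /l divr_gt0 ?mulr_gt0.
exists (del ^+ 2 * kap ^+ 2 / 24).
  by rewrite divr_gt0 ?mulr_gt0 ?exprn_gt0.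
move=> s n d Y s0 Y1.
pose e0 := expR (l * (1 - del) * kap).
pose f (v : 'I_d -> R) := e0 * expR (- (l * `|s^-1 * dotv v Y|)).
have e00 : 0 < e0 by exact: expR_gt0.
have f0 v : 0 <= f v by rewrite mulr_ge0 ?expR_ge0// ltW.
have mdot (d' : measure_display) (T' : measurableType d') (g : 'I_d -> T' -> R) :
    (forall k, measurable_fun setT (g k)) ->
    measurable_fun setT (fun t' : T' => expR (- (l * `|s^-1 * dotv (g^~ t') Y|))).
  move=> mg; apply: measurableT_comp => //; apply: measurableT_comp => //.
  apply: measurable_funM => //; apply: measurableT_comp => //.
  apply: measurable_funM => //; apply: measurable_sum => k.
  exact: measurable_funM.
have mf : vmeasurable f.
  by move=> d' T' g mg; apply: measurable_funM => //; exact: mdot.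
pose p := expR (- (del ^+ 2 * kap ^+ 2 / 24)).
have fp : (gauss_iter s d (fun w => (f (fun k : 'I_d => w k))%:E) <= p%:E)%E.
  rewrite (_ : (fun w => _) = (fun w : nat -> R => e0%:E *
     (expR (- (l * `|s^-1 * dotv (fun k : 'I_d => w k) Y|)))%:E)%E); last first.
    by apply/funext => w; rewrite -EFinM.
  rewrite gauss_iterZl; first last.
  - move=> d' T' g mg; apply/measurable_EFinP.
    exact: (mdot d' T' (fun k => g k) (fun k => mg _)).
  - by move=> w; rewrite lee_fin expR_ge0.
  - by rewrite lee_fin ltW.
  pose h (x : R) := expR (- (l * `|s^-1 * x|)).
  have ch : continuous h.
    move=> x; apply: (@continuous_comp _ _ _ (fun x : R => - (l * `|s^-1 * x|)) expR);
      last exact: continuous_expR.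
    apply: cvgN; apply: cvgM; first exact: cvg_cst.
    apply: (@continuous_comp _ _ _ (fun x : R => s^-1 * x) (fun x => `|x|));
      last exact: norm_continuous.
    by apply: cvgM; [exact: cvg_cst|exact: cvg_id].
  have := @gauss_iter_linear R s d (ext Y) h s0 ch (fun x => expR_ge0 _).
  rewrite (_ : (fun w => _) = (fun w : nat -> R =>
     (expR (- (l * `|s^-1 * dotv (fun k : 'I_d => w k) Y|)))%:E)); last first.
    apply/funext => w; rewrite /h /dotv; congr (expR (- (l * `|_ * _|)))%:E.
    by apply: eq_bigr => k _; rewrite extE mulrC.
  move=> ->.
  have -> : \sum_(k < d) ext Y k ^+ 2 = 1.
    by rewrite -Y1 dotv_sqr; apply: eq_bigr => k _; rewrite extE.
  rewrite sqrtr1 mulr1.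
  have -> : (\int[normal_prob 0 1]_x (h (s * x))%:E =
     \int[normal_prob 0 1]_x (expR (- (l * `|x|)))%:E)%E.
    by apply: eq_integral => x _; rewrite /h mulKf// gt_eqF.
  apply: (@le_trans _ _ (e0%:E * (1 - l * kap + 6 * l ^+ 2)%:E)%E).
    apply: lee_wpmul2l; first by rewrite lee_fin ltW.
    by apply: Habs; exact: ltW.
  rewrite -EFinM lee_fin.
  apply: (@le_trans _ _ (e0 * expR (- (l * kap) + 6 * l ^+ 2))).
    rewrite ler_pM2l//; apply: le_trans (expR_ge1Dx _).
    by rewrite addrA.
  rewrite /e0 /p -expRD ler_expR /l le_eqVlt; apply/orP; left; apply/eqP.
  by field.
exists (fun w => \prod_(i < n) f (fun k => w (i * d + k)%N)); split.
- by move=> w; apply: prodr_ge0 => i _; exact: f0.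
- move=> d' T' g mg; apply: measurable_prod => i _.
  exact: (mf d' T' (fun k => g (i * d + k)%N) (fun k => mg _)).
- have := @gauss_iter_blocks R s d n (fun=> f) (fun=> p) (fun=> f0) (fun=> mf) (fun _ _ => fp).
  rewrite prodr_const card_ord /p -expRM_natl.
  by rewrite mulrN mulrC.
- move=> w; rewrite /f.
  rewrite (eq_bigr (fun i : 'I_n => expR (l * (1 - del) * kap -
     l * s^-1 * `|dotv (vecs n d 0 w i) Y|))); last first.
    move=> i _; rewrite -expRD; congr expR; rewrite normrM gtr0_norm ?invr_gt0//.
    by rewrite mulrA.
  rewrite -expR_sum -[ltRHS]expR0 ltr_expR big_split /= sumr_const card_ord.
  rewrite sumrN -mulr_sumr.
  set S := \sum_i _ => h.
  have ls : 0 < l * s^-1 by rewrite mulr_gt0 ?invr_gt0.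
  rewrite -(ler_pM2l ls).
  rewrite (_ : l * s^-1 * ((1 - del) * kap * s * n%:R) = (l * (1 - del) * kap) *+ n).
    by lra.
  by rewrite -mulr_natr; field; rewrite gt_eqF.
Qed.
End block_sums.

(** * Bounds uniform in the direction *)

Section uniform_events.
Context {R : realType}.

Lemma ln_le_nat (d : nat) : (0 < d)%N -> ln d%:R <= d%:R :> R.
Proof.
move=> d0; have := expR_ge1Dx (ln d%:R : R).
by rewrite lnK ?posrE ?ltr0n//; lra.
Qed.

Lemma dotvB d (u x y : 'I_d -> R) :
  dotv u (fun k => x k - y k) = dotv u x - dotv u y.
Proof. by rewrite /dotv -sumrB; apply: eq_bigr => k _; rewrite mulrBr. Qed.

Lemma dotv_near d (x y : 'I_d -> R) : (0 < d)%N ->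
  (forall k, `|x k - y k| <= (d%:R ^+ 2)^-1) ->
  dotv (fun k => x k - y k) (fun k => x k - y k) <= (d%:R ^+ 3)^-1 :> R.
Proof.
move=> d0 xy; have dp : 0 < d%:R :> R by rewrite ltr0n.
rewrite dotv_sqr; apply: (@le_trans _ _ (\sum_(k < d) ((d%:R ^+ 2)^-1) ^+ 2)).
  apply: ler_sum => k _; rewrite -[leLHS]real_normK ?num_real//.
  by apply: lerXn2r; rewrite ?nnegrE ?invr_ge0 ?sqr_ge0.
rewrite sumr_const card_ord -mulr_natl le_eqVlt; apply/orP; left; apply/eqP.
by field; rewrite gt_eqF.
Qed.

(** The coordinate bounds give total mass at most [d T], and the net error has squared norm at most
    [d^-3], so the error term is at most [T / d^2]. The split
    [(a + b)^2 <= (1 + 1/d) a^2 + (1 + d) b^2] then costs only a factor [1 + 3/d]. *)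
Lemma sum_sqr_dotv_near n d (u : 'I_n -> 'I_d -> R) (T : R) : (0 < d)%N ->
  (forall x, dotv x x = 1 -> exists Y, [/\ dotv Y Y = 1,
    forall k, `|x k - Y k| <= (d%:R ^+ 2)^-1 &
    \sum_(i < n) dotv (u i) Y ^+ 2 <= T]) ->
  (forall k, \sum_(i < n) u i k ^+ 2 <= T) ->
  forall x, dotv x x = 1 -> \sum_(i < n) dotv (u i) x ^+ 2 <= (1 + 3 / d%:R) * T.
Proof.
move=> d0 HY Hk x x1; have dp : 0 < d%:R :> R by rewrite ltr0n.
have dge1 : 1 <= d%:R :> R by rewrite ler1n.
have [Y [Y1 xY YT]] := HY x x1.
have T0 : 0 <= T by apply: le_trans YT; apply: sumr_ge0 => i _; exact: sqr_ge0.
pose z k := x k - Y k.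
have z3 : dotv z z <= (d%:R ^+ 3)^-1 by exact: dotv_near.
have step i : dotv (u i) x ^+ 2 <= (1 + d%:R^-1) * dotv (u i) Y ^+ 2 +
    (1 + d%:R) * dotv (u i) z ^+ 2.
  have -> : dotv (u i) x = dotv (u i) Y + dotv (u i) z.
    by rewrite dotvB subrKC.
  set a := dotv _ Y; set b := dotv _ z.
  rewrite -(ler_pM2l dp) -subr_ge0.
  rewrite (_ : _ - _ = (a - d%:R * b) ^+ 2); first exact: sqr_ge0.
  by field; rewrite gt_eqF.
have zb : \sum_(i < n) dotv (u i) z ^+ 2 <= T / d%:R ^+ 2.
  apply: (@le_trans _ _ (\sum_(i < n) (\sum_(k < d) u i k ^+ 2) * (d%:R ^+ 3)^-1)).
    apply: ler_sum => i _; apply: le_trans (cauchy_schwarz _ _) _.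
    apply: ler_wpM2l; first exact: sum_sqr_ge0.
    by rewrite -dotv_sqr.
  rewrite -mulr_suml exchange_big.
  apply: (@le_trans _ _ ((\sum_(k < d) T) * (d%:R ^+ 3)^-1)).
    by apply: ler_wpM2r; [rewrite invr_ge0 exprn_ge0|apply: ler_sum => k _].
  rewrite sumr_const card_ord -mulr_natl le_eqVlt; apply/orP; left; apply/eqP.
  by field; rewrite gt_eqF.
apply: (le_trans (ler_sum _ (fun i _ => step i))).
rewrite big_split /= -!mulr_sumr.
apply: (@le_trans _ _ ((1 + d%:R^-1) * T + (1 + d%:R) * (T / d%:R ^+ 2))).
  by apply: lerD; apply: ler_wpM2l.
rewrite -subr_ge0 (_ : _ - _ = T * (d%:R - 1) / d%:R ^+ 2); last first.
  by field; rewrite gt_eqF.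
by rewrite divr_ge0 ?sqr_ge0// mulr_ge0// subr_ge0.
Qed.

Lemma likely_opnorm (eta c1 : R) : 0 < eta -> 0 < c1 ->
  exists M : R, forall d n : nat, (0 < d)%N -> M <= ln d%:R ->
  c1 * d%:R ^+ 2 / ln d%:R <= n%:R ->
  likely (sd_of R d) (n * d) (2 * expR (- (2 * d%:R))) (fun w => forall x,
    \sum_(i < n) dotv (vecs n d 0 w i) x ^+ 2 <=
    (1 + eta) * (n%:R / d%:R) * dotv x x).
Proof.
move=> eta0 c10.
have eta2 : 0 < eta / 2 by rewrite divr_gt0.
have [c c0 Hc] := likely_sum_sqr_dotv eta2.
have [M1 HM1] := net_asymp (mulr_gt0 c0 c10).
exists (Num.max M1 (Num.max 0 (3 * (2 + eta) / eta))) => d n d0.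
rewrite !ge_max => /and3P[L1 L0 Lb] Hn.
have dp : 0 < d%:R :> R by rewrite ltr0n.
have dge1 : 1 <= d%:R :> R by rewrite ler1n.
have sp := sd_gt0 d0 : 0 < sd_of R d.
have cn : d%:R * (2 * ln d%:R + 4) <= c * n%:R :> R.
  by apply: HM1 => //; rewrite -(mulrA c) -(mulrA c) ler_pM2l.
set T := (1 + eta / 2) * sd_of R d ^+ 2 * n%:R.
have T0 : 0 <= T by rewrite /T mulr_ge0// mulr_ge0 ?sqr_ge0//; lra.
have l1 := likely_net d0 cn (fun Y Y1 => Hc (sd_of R d) n d Y sp Y1).
(* The bound in the basis directions supplies the a priori control of the coordinates that the net
   argument needs. *)
pose e (k : 'I_d) (l : 'I_d) : R := (l == k)%:R.
have e1 k : dotv (e k) (e k) = 1.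
  rewrite /dotv (bigD1 k)//= /e eqxx mulr1 big1 ?addr0// => l /negbTE ->.
  by rewrite mul0r.
have l2 := likely_all (fun k => Hc (sd_of R d) n d (e k) sp (e1 k)).
have := likely_and l1 l2; apply: likely_sub.
  rewrite [leRHS]mulr_natl mulr2n lerD2l card_ord.
  rewrite -{1}[d%:R]lnK ?posrE// -expRD ler_expR.
  have : ln d%:R * 1 <= ln d%:R * d%:R :> R by apply: ler_wpM2l.
  nra.
move=> w [w1 w2] x.
have Hk k : \sum_(i < n) vecs n d 0 w i k ^+ 2 <= T.
  apply: le_trans (w2 k); apply: ler_sum => i _.
  rewrite /dotv (bigD1 k)//= /e eqxx mulr1 big1 ?addr0// => l /negbTE ->.
  by rewrite mulr0.
have Hunit := sum_sqr_dotv_near d0 w1 Hk.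
have [x0|/eqP x0] := eqVneq (dotv x x) 0.
  rewrite x0 mulr0 (dotv_eq0 x0) big1// => i _.
  by rewrite /dotv big1 ?expr0n// => k _; rewrite mulr0.
have [y [y1 xy]] := unit_scale x0.
rewrite -enorm_sqr.
rewrite (eq_bigr (fun i : 'I_n => enorm x ^+ 2 * dotv (vecs n d 0 w i) y ^+ 2)); last first.
  by move=> i _; rewrite {1}xy dotvZr exprMn.
rewrite -mulr_sumr mulrC; apply: ler_wpM2r; first exact: sqr_ge0.
apply: le_trans (Hunit y y1) _.
rewrite sd_sqr (_ : _ * _ = (1 + 3 / d%:R) * (1 + eta / 2) * (n%:R / d%:R)); last first.
  by field; rewrite gt_eqF.
apply: ler_wpM2r; first by rewrite divr_ge0// ltW.
have : 3 * (2 + eta) / eta <= d%:R by apply: le_trans Lb (ln_le_nat d0).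
rewrite ler_pdivrMr// => h.
rewrite -(ler_pM2l dp).
rewrite (_ : d%:R * ((1 + 3 / d%:R) * _) = (d%:R + 3) * (1 + eta / 2)); last first.
  by field; rewrite gt_eqF.
lra.
Qed.

Lemma likely_max (del c1 : R) : 0 < del -> del < 1 -> 0 < c1 ->
  exists M : R, forall d n : nat, (0 < d)%N -> M <= ln d%:R ->
  c1 * d%:R ^+ 2 / ln d%:R <= n%:R ->
  likely (sd_of R d) (n * d)
    (expR (- (2 * d%:R)) + d%:R ^+ 3 * (2 * expR (- (d%:R / 2))))
    (fun w => forall y, exists i : 'I_n,
      (1 - del) * Num.sqrt (2 * ln d%:R) * sd_of R d * enorm y <=
      dotv (vecs n d 0 w i) y).
Proof.
move=> del0 del1 c10.
pose a := Num.min c1 1.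
have a0 : 0 < a by rewrite lt_min c10 ltr01.
have del20 : 0 < del / 2 by rewrite divr_gt0.
have del21 : del / 2 <= 1 by lra.
have [M1 HM1] := gtail_asymp a0 del20 del21.
exists (Num.max M1 (Num.max 1 (2 / del ^+ 2))) => d n d0.
rewrite !ge_max => /and3P[L1 L0 Lb] Hn.
have dp : 0 < d%:R :> R by rewrite ltr0n.
have dge1 : 1 <= d%:R :> R by rewrite ler1n.
have sp := sd_gt0 d0 : 0 < sd_of R d.
set s := sd_of R d in sp *.
set L := ln d%:R in L1 L0 Lb Hn *.
have dL : d%:R = expR L by rewrite lnK ?posrE.
(* The cap keeps the union bound on coordinates to [d^3] terms however large [n] is, while [n']
   stays above a multiple of [d^2 / L]. *)
pose n' := minn n (d ^ 2).
have n'n : (n' <= n)%N by exact: geq_minl.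
have Lp : 0 < L by lra.
have n'ge : a * d%:R ^+ 2 / L <= n'%:R.
  rewrite /n' /minn; case: ifP => _.
    apply: le_trans Hn; rewrite ler_pM2r ?invr_gt0// ler_pM2r ?exprn_gt0//.
    by rewrite ge_min lexx.
  rewrite natrX ler_pdivrMr// mulrC ler_pM2l ?exprn_gt0//.
  by apply: le_trans L0; rewrite ge_min lexx orbT.
set t := (1 - del / 2) * Num.sqrt (2 * L).
have t0 : 0 <= t by rewrite mulr_ge0 ?sqrtr_ge0//; lra.
have g0 : 0 <= gtail t by rewrite divr_ge0 ?expR_ge0.
have En : d%:R * (2 * L + 4) <= gtail t * n'%:R.
  apply: (@le_trans _ _ (gtail t * (a * d%:R ^+ 2 / L))); last exact: ler_wpM2l.
  rewrite mulrA ler_pdivlMr//.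
  have := HM1 L L1; rewrite -/t -dL => h.
  rewrite (_ : gtail t * (a * d%:R ^+ 2) = d%:R * (a * d%:R * gtail t)); last by ring.
  by rewrite -[leLHS]mulrA ler_pM2l// [leLHS]mulrC.
have l1 := likely_net d0 En (fun Y Y1 => likely_exists_large sp t0 n'n Y1).
have jlt (j : 'I_(n' * d)) : (j < n * d)%N.
  by apply: leq_trans (ltn_ord j) _; rewrite leq_mul2r n'n orbT.
have l2 := likely_all (fun j : 'I_(n' * d) => likely_coord sp dp (jlt j)).
have := likely_and l1 l2; apply: likely_sub.
  rewrite lerD2l card_ord.
  apply: ler_pM; rewrite ?ler0n ?mulr_ge0 ?expR_ge0//.
    rewrite natrM exprSr; apply: ler_wpM2r; first exact: ltW.
    by rewrite -natrX ler_nat geq_minr.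
  rewrite ler_pM2l// ler_expR sd_sqr le_eqVlt; apply/orP; left; apply/eqP.
  by field; rewrite gt_eqF.
move=> w [w1 w2].
have n0 : (0 < n)%N.
  rewrite -(@ltr0n R); apply: lt_le_trans Hn.
  by rewrite divr_gt0// mulr_gt0 ?exprn_gt0.
have Hunit x : dotv x x = 1 -> exists i : 'I_n,
    (1 - del) * Num.sqrt (2 * L) * s <= dotv (vecs n d 0 w i) x.
  move=> x1; have [Y [Y1 xY [i ilt HY]]] := w1 x x1; exists i.
  have -> : dotv (vecs n d 0 w i) x = dotv (vecs n d 0 w i) Y +
      dotv (vecs n d 0 w i) (fun k => x k - Y k) by rewrite dotvB subrKC.
  (* There are [d] coordinates of size at most 1, each times [d^-2]: the error is [1/d = s^2], which
     the other half of [del] absorbs. *)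
  have zb : `|dotv (vecs n d 0 w i) (fun k => x k - Y k)| <= s ^+ 2.
    apply: le_trans (ler_norm_sum _ _ _) _.
    apply: (@le_trans _ _ (\sum_(k < d) (d%:R ^+ 2)^-1)).
      apply: ler_sum => k _; rewrite normrM -[leRHS]mul1r.
      apply: ler_pM => //.
      have jl : (i * d + k < n' * d)%N.
        apply: (@leq_trans (i.+1 * d)); last by rewrite leq_mul2r ilt orbT.
        by rewrite mulSn addnC ltn_add2r.
      exact: (w2 (Ordinal jl)).
    rewrite sumr_const card_ord sd_sqr -mulr_natl le_eqVlt; apply/orP; left; apply/eqP.
    by field; rewrite gt_eqF.
  have sle1 : s <= 1.
    rewrite -(@ler_pXn2r _ 2%N) ?nnegrE//; last exact: ltW.
    rewrite sd_sqr expr1n.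
    by rewrite invf_le1.
  have sq : 1 <= del / 2 * Num.sqrt (2 * L).
    have rhs0 : 0 <= del / 2 * Num.sqrt (2 * L) by rewrite mulr_ge0 ?sqrtr_ge0// ltW.
    rewrite -(@ler_pXn2r _ 2%N) ?nnegrE//.
    rewrite expr1n !exprMn sqr_sqrtr; last by rewrite mulr_ge0// ltW.
    have : 2 <= L * del ^+ 2 by rewrite -ler_pdivrMr ?exprn_gt0.
    nra.
  move: zb; rewrite ler_norml => /andP[zb _].
  have : s ^+ 2 <= s * (del / 2 * Num.sqrt (2 * L)).
    by rewrite expr2; apply: ler_wpM2l; [exact: ltW|lra].
  move: HY; rewrite /t.
  set q := Num.sqrt _.
  rewrite (_ : s * ((1 - del / 2) * q) = s * q - s * (del / 2 * q)); last by ring.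
  rewrite (_ : (1 - del) * q * s = s * q - 2 * (s * (del / 2 * q))); last by field.
  lra.
move=> y.
have [y0|/eqP y0] := eqVneq (dotv y y) 0.
  exists (Ordinal n0); rewrite /enorm y0 sqrtr0 mulr0 (dotv_eq0 y0).
  by rewrite /dotv big1// => k _; rewrite mulr0.
have [x [x1 yx]] := unit_scale y0.
have [i Hi] := Hunit x x1; exists i.
rewrite [in leRHS]yx dotvZr mulrC; apply: ler_wpM2l => //; exact: enorm_ge0.
Qed.

(** The net error is a first moment in the direction [z]; Cauchy-Schwarz over [i] reduces it to the
    operator norm bound, used only crudely, with [eta = 1]. *)
Lemma likely_sum_abs (del c1 : R) : 0 < del -> del < 1 -> 0 < c1 ->
  exists M : R, forall d n : nat, (0 < d)%N -> M <= ln d%:R ->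
  c1 * d%:R ^+ 2 / ln d%:R <= n%:R ->
  likely (sd_of R d) (n * d) (3 * expR (- (2 * d%:R))) (fun w => forall x,
    (1 - del) * (2 * normal_peak 1) * sd_of R d * n%:R * enorm x <=
    \sum_(i < n) `|dotv (vecs n d 0 w i) x|).
Proof.
move=> del0 del1 c10.
have del2 : 0 < del / 2 by rewrite divr_gt0.
have del21 : del / 2 < 1 by lra.
have [c c0 Hc] := likely_sum_abs_dotv del2 del21.
have [M1 HM1] := net_asymp (mulr_gt0 c0 c10).
have [M2 HM2] := likely_opnorm ltr01 c10.
have kap0 : 0 < 2 * normal_peak (1 : R).
  by rewrite mulr_gt0 ?normal_peak_gt0 ?oner_neq0.
set kap := 2 * normal_peak (1 : R) in Hc kap0 *; clearbody kap.
exists (Num.max M1 (Num.max M2 (4 / (del * kap)))) => d n d0.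
rewrite !ge_max => /and3P[L1 L2 Lb] Hn.
have dp : 0 < d%:R :> R by rewrite ltr0n.
have sp := sd_gt0 d0 : 0 < sd_of R d.
have cn : d%:R * (2 * ln d%:R + 4) <= c * n%:R :> R.
  by apply: HM1 => //; rewrite -(mulrA c) -(mulrA c) ler_pM2l.
have l1 := likely_net d0 cn (fun Y Y1 => Hc (sd_of R d) n d Y sp Y1).
have := likely_and l1 (HM2 d n d0 L2 Hn); apply: likely_sub; first by lra.
move=> w [w1 w2].
set s := sd_of R d in sp w1 *.
have Hunit x : dotv x x = 1 -> (1 - del) * kap * s * n%:R <=
    \sum_(i < n) `|dotv (vecs n d 0 w i) x|.
  move=> x1; have [Y [Y1 xY HY]] := w1 x x1.
  pose z k := x k - Y k.
  have z3 : dotv z z <= (d%:R ^+ 3)^-1 by exact: dotv_near.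
  have tri : \sum_(i < n) `|dotv (vecs n d 0 w i) Y| -
      \sum_(i < n) `|dotv (vecs n d 0 w i) z| <= \sum_(i < n) `|dotv (vecs n d 0 w i) x|.
    rewrite -sumrB; apply: ler_sum => i _.
    rewrite dotvB lerBlDr.
    set p := dotv _ x; set q := dotv _ Y.
    by rewrite -[leLHS](_ : `|p - (p - q)| = _) ?ler_normB// subKr.
  set S := \sum_(i < n) `|dotv _ z| in tri.
  have S0 : 0 <= S by apply: sumr_ge0 => i _.
  have zb : S <= 2 * n%:R * s / d%:R.
    have rhs0 : 0 <= 2 * n%:R * s / d%:R.
      by apply: divr_ge0; [apply: mulr_ge0; [exact: mulr_ge0|exact: ltW]|exact: ltW].
    rewrite -(@ler_pXn2r _ 2%N) ?nnegrE//.
    have := cauchy_schwarz (fun=> 1) (fun i : 'I_n => `|dotv (vecs n d 0 w i) z|).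
    rewrite (eq_bigr (fun i : 'I_n => `|dotv (vecs n d 0 w i) z|)); last first.
      by move=> i _; rewrite mul1r.
    rewrite -/S => /le_trans; apply.
    rewrite expr1n sumr_const card_ord.
    rewrite (eq_bigr (fun i : 'I_n => dotv (vecs n d 0 w i) z ^+ 2)); last first.
      by move=> i _; rewrite real_normK ?num_real.
    apply: (@le_trans _ _ (n%:R * ((1 + 1) * (n%:R / d%:R) * (d%:R ^+ 3)^-1))).
      apply: ler_wpM2l => //; apply: le_trans (w2 z) _.
      by apply: ler_wpM2l => //; rewrite mulr_ge0// divr_ge0// ltW.
    have s2 : s ^+ 2 = d%:R^-1 by exact: sd_sqr.
    rewrite (_ : (2 * n%:R * s / d%:R) ^+ 2 = 4 * n%:R ^+ 2 * s ^+ 2 / d%:R ^+ 2); last first.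
      by field; rewrite gt_eqF.
    rewrite s2 -subr_ge0 (_ : _ - _ = n%:R ^+ 2 * (4 * d%:R - 2) / d%:R ^+ 4); last first.
      by field; rewrite gt_eqF.
    apply: divr_ge0; last by apply: exprn_ge0.
    apply: mulr_ge0; first exact: sqr_ge0.
    have : 1 <= d%:R :> R by rewrite ler1n.
    lra.
  have : 4 / (del * kap) <= d%:R by apply: le_trans Lb (ln_le_nat d0).
  rewrite ler_pdivrMr ?mulr_gt0// => h.
  have : 2 * n%:R * s / d%:R <= del / 2 * kap * s * n%:R.
    rewrite ler_pdivrMr//.
    have : n%:R * s * 4 <= n%:R * s * (d%:R * (del * kap)).
      by apply: ler_wpM2l => //; rewrite mulr_ge0// ltW.
    lra.
  move: HY => /=; set S' := \sum_(i < n) `|dotv _ Y| in tri *.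
  lra.
move=> x.
have [x0|/eqP x0] := eqVneq (dotv x x) 0.
  by rewrite /enorm x0 sqrtr0 mulr0; apply: sumr_ge0 => i _.
have [y [y1 xy]] := unit_scale x0.
rewrite [in leRHS](eq_bigr (fun i : 'I_n => enorm x * `|dotv (vecs n d 0 w i) y|)); last first.
  by move=> i _; rewrite {1}xy dotvZr normrM ger0_norm ?enorm_ge0.
rewrite -mulr_sumr mulrC; apply: ler_wpM2l; first exact: enorm_ge0.
exact: Hunit.
Qed.
End uniform_events.

(** * Deterministic part *)

Section deterministic.
Context {R : realType}.

Definition mulv d (W : 'I_d -> 'I_d -> R) (x : 'I_d -> R) : 'I_d -> R :=
  fun k => dotv (W k) x.

Definition frob d (W : 'I_d -> 'I_d -> R) : R := \sum_(k < d) dotv (W k) (W k).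

Lemma bilinE d (u : 'I_d -> R) W x : bilin u W x = dotv u (mulv W x).
Proof.
rewrite /bilin /dotv /mulv /dotv; apply: eq_bigr => k _.
by rewrite mulr_sumr; apply: eq_bigr => l _; rewrite mulrA.
Qed.

Lemma frob_ge0 d (W : 'I_d -> 'I_d -> R) : 0 <= frob W.
Proof. by apply: sumr_ge0 => k _; exact: dotv_ge0. Qed.

Lemma not_separable n d (u v : 'I_n -> 'I_d -> R) (t g Fr : R) :
  (1 < n)%N -> 0 < t -> 0 < g ->
  (forall y, exists i, t * enorm y <= dotv (u i) y) ->
  (forall W, g * Num.sqrt (frob W) <= \sum_(i < n) enorm (mulv W (v i))) ->
  \sum_(k < d) \sum_(l < d) (\sum_(i < n) u i k * v i l) ^+ 2 <= Fr ->
  Fr < (t * g) ^+ 2 -> ~ separable u v.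
Proof.
move=> n1 t0 g0 Hmax Hlow HFr Frlt [W HW].
set f := frob W.
have f0 : 0 <= f by exact: frob_ge0.
(* For [W = 0] all scores vanish, and two distinct indices, available since [1 < n], contradict the
   strict inequality. *)
have [f00|fn0] := eqVneq f 0.
  have W0 k : W k = (fun _ => 0).
    by apply: dotv_eq0; move/psumr_eq0P : f00; apply => // l _; exact: dotv_ge0.
  have b0 i j : bilin (u i) W (v j) = 0.
    by rewrite bilinE /dotv big1// => k _; rewrite /mulv W0 /dotv big1 ?mulr0// => l _; rewrite mul0r.
  have := HW (Ordinal (ltnW n1)) (Ordinal n1) isT.
  by rewrite !b0 ltxx.
have fp : 0 < f by rewrite lt_neqAle eq_sym fn0.
pose P := \sum_(i < n) bilin (u i) W (v i).
have Pge : t * g * Num.sqrt f <= P.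
  rewrite -mulrA; apply: (@le_trans _ _ (t * \sum_(i < n) enorm (mulv W (v i)))).
    by apply: ler_wpM2l; [exact: ltW|exact: Hlow].
  rewrite mulr_sumr; apply: ler_sum => i _.
  have [j Hj] := Hmax (mulv W (v i)).
  apply: le_trans Hj _; rewrite -bilinE.
  have [->//|ji] := eqVneq j i.
  by apply: ltW; exact: HW.
pose M k l := \sum_(i < n) u i k * v i l.
have PE : P = \sum_(kl : 'I_d * 'I_d) W kl.1 kl.2 * M kl.1 kl.2.
  rewrite -(pair_bigA _ (fun k l => W k l * M k l)) /=.
  rewrite /P /bilin exchange_big; apply: eq_bigr => k _.
  rewrite exchange_big; apply: eq_bigr => l _.
  by rewrite /M mulr_sumr; apply: eq_bigr => i _; ring.
have P2 : P ^+ 2 <= f * Fr.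
  rewrite PE; apply: le_trans (cauchy_schwarz _ _) _.
  rewrite -(pair_bigA _ (fun k l => W k l ^+ 2)) -(pair_bigA _ (fun k l => M k l ^+ 2)) /=.
  rewrite (_ : \sum_(i < d) \sum_(j < d) W i j ^+ 2 = f); last first.
    by apply: eq_bigr => k _; rewrite dotv_sqr.
  exact: ler_wpM2l.
have : (t * g * Num.sqrt f) ^+ 2 <= P ^+ 2.
  have h0 : 0 <= t * g * Num.sqrt f by rewrite mulr_ge0 ?sqrtr_ge0// mulr_ge0// ltW.
  by apply: lerXn2r; rewrite ?nnegrE//; exact: le_trans Pge.
rewrite exprMn sqr_sqrtr// => h.
have := le_trans h P2; rewrite mulrC ler_pM2l// => h'.
by have := le_lt_trans h' Frlt; rewrite ltxx.
Qed.

(* Minkowski's inequality for the rows of W reduces general W to rank one. *)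
Lemma sum_enorm_ge_abs n d (v : 'I_n -> 'I_d -> R) (g : R) : 0 <= g ->
  (forall x, g * enorm x <= \sum_(i < n) `|dotv (v i) x|) ->
  forall W, g * Num.sqrt (frob W) <= \sum_(i < n) enorm (mulv W (v i)).
Proof.
move=> g0 Hg W.
(* Minkowski by duality: [|b|^2] is the sum over [i] of the pairing of [b] with the absolute values
   of [W v_i], hence at most [|b| S]. *)
pose b k := \sum_(i < n) `|dotv (v i) (W k)|.
have b0 k : 0 <= b k by apply: sumr_ge0 => i _.
set S := \sum_(i < n) enorm _.
have S0 : 0 <= S by apply: sumr_ge0 => i _; exact: enorm_ge0.
have gb : g ^+ 2 * frob W <= dotv b b.
  rewrite dotv_sqr /frob mulr_sumr; apply: ler_sum => k _.
  rewrite -enorm_sqr -exprMn; apply: lerXn2r; rewrite ?nnegrE ?mulr_ge0 ?enorm_ge0//.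
have bS : dotv b b <= enorm b * S.
  have -> : dotv b b = \sum_(i < n) \sum_(k < d) b k * `|dotv (v i) (W k)|.
    by rewrite exchange_big; apply: eq_bigr => k _; rewrite -mulr_sumr.
  rewrite mulr_sumr; apply: ler_sum => i _.
  have T0 : 0 <= \sum_(k < d) b k * `|dotv (v i) (W k)|.
    by apply: sumr_ge0 => k _; rewrite mulr_ge0.
  have r0 : 0 <= enorm b * enorm (mulv W (v i)) by rewrite mulr_ge0 ?enorm_ge0.
  rewrite -(@ler_pXn2r _ 2%N) ?nnegrE// exprMn !enorm_sqr.
  apply: le_trans (cauchy_schwarz _ _) _; rewrite -dotv_sqr dotv_sqr dotv_sqr.
  rewrite le_eqVlt; apply/orP; left; apply/eqP; congr (_ * _).
  apply: eq_bigr => k _; rewrite real_normK ?num_real// /mulv /dotv; congr (_ ^+ 2).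
  by apply: eq_bigr => l _; rewrite mulrC.
have bleS : enorm b <= S.
  have := enorm_ge0 b; rewrite le_eqVlt => /orP[/eqP <- //|bp].
  by rewrite -(ler_pM2l bp) -expr2 enorm_sqr.
apply: le_trans bleS.
have h0 : 0 <= g * Num.sqrt (frob W) by rewrite mulr_ge0 ?sqrtr_ge0.
rewrite -(@ler_pXn2r _ 2%N) ?nnegrE ?enorm_ge0// exprMn sqr_sqrtr ?frob_ge0//.
by rewrite enorm_sqr.
Qed.

Lemma sum_pow4_dotv n d (v : 'I_n -> 'I_d -> R) (K2 : R) :
  (0 < d)%N -> (0 < n)%N ->
  (forall x : 'I_d -> R, enorm x = 1 ->
     n%:R^-1 * \sum_(i < n) dotv (v i) x ^+ 4 <= K2 / d%:R ^+ 2) ->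
  forall x, \sum_(i < n) dotv (v i) x ^+ 4 <=
    K2 * n%:R / d%:R ^+ 2 * dotv x x ^+ 2.
Proof.
move=> d0 n0 H4 x.
have np : 0 < n%:R :> R by rewrite ltr0n.
have [x0|/eqP x0] := eqVneq (dotv x x) 0.
  rewrite x0 expr0n mulr0 (dotv_eq0 x0) big1// => i _.
  by rewrite /dotv big1 ?expr0n// => k _; rewrite mulr0.
have [y [y1 xy]] := unit_scale x0.
have := H4 y; rewrite /enorm y1 sqrtr1 => /(_ erefl).
rewrite ler_pdivrMl// => h.
rewrite (eq_bigr (fun i : 'I_n => enorm x ^+ 4 * dotv (v i) y ^+ 4)); last first.
  by move=> i _; rewrite {1}xy dotvZr exprMn.
rewrite -mulr_sumr -enorm_sqr -exprM mulrC.
apply: ler_wpM2r; first by rewrite exprn_ge0 ?enorm_ge0.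
apply: le_trans h _; rewrite le_eqVlt; apply/orP; left; apply/eqP.
by rewrite mulrCA mulrA.
Qed.

(** The second moment is only assumed bounded below; the upper bound needed for [|M|_F] comes from
    the fourth moment by Cauchy-Schwarz. *)
Lemma sum_sqr_dotv_pow4 n d (v : 'I_n -> 'I_d -> R) (K2 : R) :
  (0 < d)%N -> (0 < n)%N -> 0 <= K2 ->
  (forall x : 'I_d -> R, enorm x = 1 ->
     n%:R^-1 * \sum_(i < n) dotv (v i) x ^+ 4 <= K2 / d%:R ^+ 2) ->
  forall x, \sum_(i < n) dotv (v i) x ^+ 2 <=
    Num.sqrt K2 * (n%:R / d%:R) * dotv x x.
Proof.
move=> d0 n0 K20 H4 x.
have dp : 0 < d%:R :> R by rewrite ltr0n.
have r0 : 0 <= Num.sqrt K2 * (n%:R / d%:R) * dotv x x.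
  by rewrite !mulr_ge0 ?sqrtr_ge0 ?dotv_ge0// invr_ge0.
have S0 : 0 <= \sum_(i < n) dotv (v i) x ^+ 2.
  by apply: sumr_ge0 => i _; exact: sqr_ge0.
rewrite -(@ler_pXn2r _ 2%N) ?nnegrE//.
have := cauchy_schwarz (fun=> 1) (fun i : 'I_n => dotv (v i) x ^+ 2).
rewrite (eq_bigr (fun i : 'I_n => dotv (v i) x ^+ 2)); last first.
  by move=> i _; rewrite mul1r.
move=> /le_trans; apply; rewrite expr1n sumr_const card_ord.
under eq_bigr do rewrite -exprM.
apply: (@le_trans _ _ (n%:R * (K2 * n%:R / d%:R ^+ 2 * dotv x x ^+ 2))).
  by apply: ler_wpM2l => //; exact: (sum_pow4_dotv d0 n0 H4 x).
rewrite !exprMn sqr_sqrtr// le_eqVlt; apply/orP; left; apply/eqP.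
by field; rewrite gt_eqF.
Qed.

(* [a >= l a^2 - l^3 a^4] interpolates the first moment between the second and
   the fourth one. *)
Lemma sum_enorm_ge_moments n d (v : 'I_n -> 'I_d -> R) (c0 K2 : R) :
  (0 < d)%N -> (0 < n)%N -> 0 < c0 -> 0 < K2 ->
  (forall x : 'I_d -> R,
     c0 / d%:R * enorm x ^+ 2 <= n%:R^-1 * \sum_(i < n) dotv (v i) x ^+ 2) ->
  (forall x : 'I_d -> R, enorm x = 1 ->
     n%:R^-1 * \sum_(i < n) dotv (v i) x ^+ 4 <= K2 / d%:R ^+ 2) ->
  forall W, (c0 / 2 * Num.sqrt (c0 / (2 * K2))) * sd_of R d * n%:R
     * Num.sqrt (frob W) <= \sum_(i < n) enorm (mulv W (v i)).
Proof.
move=> d0 n0 c00 K20 H2 H4 W.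
have dp : 0 < d%:R :> R by rewrite ltr0n.
have np : 0 < n%:R :> R by rewrite ltr0n.
have [f00|fn0] := eqVneq (frob W) 0.
  by rewrite f00 sqrtr0 mulr0; apply: sumr_ge0 => i _; exact: enorm_ge0.
have fp : 0 < frob W by rewrite lt_neqAle eq_sym fn0 frob_ge0.
set f := frob W in fp *.
have H4' := sum_pow4_dotv d0 n0 H4.
pose a i := enorm (mulv W (v i)).
have a0 i : 0 <= a i by exact: enorm_ge0.
have aE i : a i ^+ 2 = \sum_(k < d) dotv (v i) (W k) ^+ 2.
  rewrite enorm_sqr dotv_sqr; apply: eq_bigr => k _; congr (_ ^+ 2).
  by apply: eq_bigr => l _; rewrite mulrC.
have A2 : c0 * n%:R / d%:R * f <= \sum_(i < n) a i ^+ 2.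
  rewrite (eq_bigr _ (fun i _ => aE i)) exchange_big /f /frob mulr_sumr.
  apply: ler_sum => k _; have := H2 (W k).
  rewrite ler_pdivlMl// enorm_sqr; apply: le_trans.
  by rewrite le_eqVlt; apply/orP; left; apply/eqP; ring.
(* Expanding [|W v_i|^4] over pairs of rows and applying Cauchy-Schwarz over [i] to each pair
   reduces to the fourth moment along single rows. *)
have A4 : \sum_(i < n) a i ^+ 4 <= K2 * n%:R / d%:R ^+ 2 * f ^+ 2.
  set Q := K2 * n%:R / d%:R ^+ 2.
  have Q0 : 0 <= Q by rewrite divr_ge0 ?sqr_ge0// mulr_ge0// ltW.
  rewrite (eq_bigr (fun i : 'I_n => \sum_(k < d) \sum_(l < d)
     dotv (v i) (W k) ^+ 2 * dotv (v i) (W l) ^+ 2)); last first.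
    move=> i _; rewrite (exprM _ 2 2) aE expr2 mulr_suml.
    by apply: eq_bigr => k _; rewrite mulr_sumr.
  rewrite exchange_big /f /frob expr2 mulr_suml mulr_sumr.
  apply: ler_sum => k _; rewrite exchange_big mulr_sumr mulr_sumr.
  apply: ler_sum => l _.
  have r0 : 0 <= Q * (dotv (W k) (W k) * dotv (W l) (W l)).
    by apply: mulr_ge0 => //; apply: mulr_ge0; exact: dotv_ge0.
  have l0 : 0 <= \sum_(i < n) dotv (v i) (W k) ^+ 2 * dotv (v i) (W l) ^+ 2.
    by apply: sumr_ge0 => i _; rewrite mulr_ge0 ?sqr_ge0.
  rewrite -(@ler_pXn2r _ 2%N) ?nnegrE//.
  apply: le_trans (cauchy_schwarz _ _) _.
  under eq_bigr do rewrite -exprM.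
  under [X in _ * X]eq_bigr do rewrite -exprM.
  rewrite (_ : (Q * _) ^+ 2 = (Q * dotv (W k) (W k) ^+ 2) * (Q * dotv (W l) (W l) ^+ 2)); last by ring.
  by apply: ler_pM => //; try (by apply: sumr_ge0 => i _; rewrite exprn_even_ge0); exact: H4'.
(* Chosen so that the bound on the fourth-moment term is half of the bound on the second-moment
   term. *)
pose lam := Num.sqrt (c0 * d%:R / (2 * K2 * f)).
have arg0 : 0 < c0 * d%:R / (2 * K2 * f) by rewrite divr_gt0 ?mulr_gt0.
have lam0 : 0 < lam by rewrite sqrtr_gt0.
have lam2 : lam ^+ 2 = c0 * d%:R / (2 * K2 * f) by rewrite sqr_sqrtr// ltW.
have point i : lam * a i ^+ 2 - lam ^+ 3 * a i ^+ 4 <= a i.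
  have y0 : 0 <= lam * a i by rewrite mulr_ge0// ltW.
  (* The interpolation inequality divided by [a i]: [1 - y + y^3 >= 0] for [y >= 0]. *)
  have : 0 <= 1 - lam * a i + (lam * a i) ^+ 3.
    have [y1|y1] := leP (lam * a i) 1; first by rewrite addr_ge0 ?subr_ge0 ?exprn_ge0.
    have : 1 <= (lam * a i) ^+ 2 by rewrite exprn_ege1// ltW.
    rewrite exprS; nra.
  move=> /(mulr_ge0 (a0 i)); rewrite exprMn => h.
  rewrite -subr_ge0; apply: le_trans h _.
  by rewrite le_eqVlt; apply/orP; left; apply/eqP; ring.
apply: le_trans (ler_sum _ (fun i _ => point i)).
rewrite sumrB -!mulr_sumr.
apply: (@le_trans _ _ (lam * (c0 * n%:R / d%:R * f) - lam ^+ 3 * (K2 * n%:R / d%:R ^+ 2 * f ^+ 2))); last first.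
  apply: lerB; first by apply: ler_wpM2l => //; exact: ltW.
  by apply: ler_wpM2l => //; rewrite exprn_ge0 ?ltW.
rewrite exprS lam2.
rewrite [leRHS](_ : _ = lam * (c0 / 2 * n%:R / d%:R * f)); last first.
  by field; rewrite !gt_eqF.
have lamE : lam * f = Num.sqrt (c0 / (2 * K2)) * Num.sqrt d%:R * Num.sqrt f.
  have -> : lam * f = Num.sqrt (lam ^+ 2 * f ^+ 2).
    by rewrite -exprMn sqrtr_sqr gtr0_norm// mulr_gt0.
  have q0 : 0 <= c0 / (2 * K2) by rewrite divr_ge0 ?mulr_ge0 ?ltW.
  have -> : lam ^+ 2 * f ^+ 2 = c0 / (2 * K2) * d%:R * f.
    by rewrite lam2; field; rewrite !gt_eqF.
  have q1 : 0 <= c0 / (2 * K2) * d%:R by rewrite mulr_ge0.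
  by rewrite sqrtrM// sqrtrM.
have sdE : Num.sqrt d%:R / d%:R = sd_of R d.
  rewrite /sd_of -{2}[d%:R]sqr_sqrtr ?ler0n// expr2 invfM mulrA divff ?mul1r//.
  by rewrite gt_eqF// sqrtr_gt0.
rewrite (_ : lam * _ = (lam * f) * (c0 / 2 * n%:R / d%:R)); last by ring.
rewrite lamE -sdE le_eqVlt; apply/orP; left; apply/eqP.
by ring.
Qed.
End deterministic.

(** * Choice of constants and assembly *)

Section final.
Context {R : realType}.

(** In (a) the failure terms are six [expR (- 2 d)] and one Frobenius term below [expR (- d)], hence
    the 7, plus the coordinate term with its factor [d^3]. The latter dominates; the rate [1/8]
    leaves room below its [1/2] to absorb the polynomial. *)
Lemma prob_asymp : exists M : R, forall d : nat, M <= d%:R ->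
  7 * expR (- d%:R) + d%:R ^+ 3 * (2 * expR (- (d%:R / 2))) <= expR (- (8^-1 * d%:R)) :> R.
Proof.
have [J JE] : exists J : R, J = 4 * 27 by exists (4 * 27).
exists (16 + J * (8 * 64)) => d Hd.
have J0 : 0 < J by lra.
have d16 : 16 <= d%:R :> R by lra.
have dJ : J * (8 * 64) <= d%:R by lra.
move: (d%:R : R) d16 dJ {Hd} => x x16 xJ.
have h1 : 14 * expR (- x) <= expR (- (8^-1 * x)).
  rewrite (_ : - (8^-1 * x) = 7 / 8 * x + - x); last by field.
  rewrite expRD ler_pM2r ?expR_gt0//.
  by have := expR_ge1Dx (7 / 8 * x); lra.
have h2 : 4 * x ^+ 3 * expR (- (x / 2)) <= expR (- (8^-1 * x)).
  rewrite (_ : - (8^-1 * x) = (x / 4 + x / 8) + - (x / 2)); last by field.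
  rewrite expRD ler_pM2r ?expR_gt0// expRD.
  have x4 : 0 <= x / 4 by lra.
  have c1 := expR_ge_cube x4.
  have c2 : x / 8 <= expR (x / 8) by have := expR_ge1Dx (x / 8); lra.
  apply: (@le_trans _ _ ((x / 4) ^+ 3 / 27 * (x / 8))); last first.
    apply: ler_pM => //; last by lra.
    by rewrite divr_ge0// exprn_ge0.
  rewrite (_ : (x / 4) ^+ 3 / 27 * (x / 8) = x ^+ 3 * (x / (27 * (8 * 64)))); last by field.
  rewrite mulrC; apply: ler_wpM2l; first by rewrite exprn_ge0//; lra.
  have -> : 4 = J * (8 * 64) / (27 * (8 * 64)) by rewrite JE; field.
  rewrite ler_pM2r// invr_gt0; lra.
have -> : x ^+ 3 * (2 * expR (- (x / 2))) = (4 * x ^+ 3 * expR (- (x / 2))) / 2 by field.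
lra.
Qed.

Lemma expR_sqr_dim_le (c : R) (d : nat) : 0 < c -> c^-1 <= d%:R ->
  expR (- (c * (d * d)%:R)) <= expR (- d%:R).
Proof.
move=> c0 cd; rewrite ler_expR lerN2 natrM mulrA -[leLHS]mul1r.
apply: ler_wpM2r => //; rewrite -[leLHS](mulfV (lt0r_neq0 c0)).
by apply: ler_wpM2l => //; exact: ltW.
Qed.

Lemma vecs_catw_l n d (u w : nat -> R) :
  vecs n d 0 (catw (n * d) u w) = vecs n d 0 u.
Proof.
apply/funext => i; apply/funext => k; rewrite /vecs /catw add0n.
rewrite (_ : (i * d + k < n * d)%N)//.
apply: (@leq_trans (i.+1 * d)); last by rewrite leq_mul2r ltn_ord orbT.
by rewrite mulSn addnC ltn_add2r.
Qed.

Lemma vecs_catw_r n d (u w : nat -> R) :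
  vecs n d n (catw (n * d) u w) = vecs n d 0 w.
Proof.
apply/funext => i; apply/funext => k; rewrite /vecs /catw add0n.
by rewrite mulnDl -addnA ltnNge leq_addr /= addKn.
Qed.

(** The losses [(1 - del)^4] come from squaring the maximum bound and the absolute-sum bound;
    [(1 + del)^2] comes from the operator norm and the Frobenius norm. *)
Lemma exists_small_del (e : R) : 0 < e -> exists del : R,
  [/\ 0 < del, del < 1 & (1 + del) ^+ 2 < (1 - del) ^+ 4 * (1 + e)].
Proof.
move=> e0; have e1 : 0 < 8 * (1 + e) by lra.
exists (e / (8 * (1 + e))); set del := e / _.
have del0 : 0 < del by rewrite divr_gt0.
have delE : del * (8 * (1 + e)) = e by rewrite divfK// gt_eqF.
have del8 : del < 1 / 8.
  by rewrite -(ltr_pM2r e1) delE; lra.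
split => //; first by lra.
have h1 : 1 - 4 * del <= (1 - del) ^+ 4.
  have sq : 1 - 2 * del <= (1 - del) ^+ 2 by nra.
  rewrite (exprM _ 2 2).
  have : (1 - 2 * del) ^+ 2 <= ((1 - del) ^+ 2) ^+ 2.
    by apply: lerXn2r; rewrite ?nnegrE ?sqr_ge0//; lra.
  by apply: le_trans; nra.
apply: (@lt_le_trans _ _ ((1 - 4 * del) * (1 + e))); last first.
  by apply: ler_wpM2r => //; lra.
nra.
Qed.

(** With [p = pi], the two sides balance at [n L = (p / 4) d^2] up to the losses in [del]; the
    surplus [eps] gains exactly the factor [1 + 4 eps / p]. *)
Lemma sharp_gap (p eps del n d L : R) : 0 < p -> 0 <= 1 - del -> 0 < n ->
  0 < d -> 0 < L -> (1 + del) ^+ 2 < (1 - del) ^+ 4 * (1 + 4 * eps / p) ->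
  (p / 4 + eps) * d ^+ 2 <= n * L ->
  (1 + del) ^+ 2 * n <
  (1 - del) ^+ 4 * (2 * L) * d^-1 ^+ 2 * (2 / p) * n ^+ 2.
Proof.
move=> p0 del1 n0 d0 L0 delE hc.
have pn0 := lt0r_neq0 p0; have dn0 := lt0r_neq0 d0.
apply: (@lt_le_trans _ _ ((1 - del) ^+ 4 * (1 + 4 * eps / p) * n)).
  by rewrite ltr_pM2r.
rewrite [leRHS](_ : _ = (1 - del) ^+ 4 * n * (4 / p / d ^+ 2) * (n * L)); last first.
  by field; rewrite pn0 dn0.
rewrite [leLHS](_ : _ = (1 - del) ^+ 4 * n * (4 / p / d ^+ 2) *
    ((p / 4 + eps) * d ^+ 2)); last first.
  by field; rewrite pn0 dn0.
apply: ler_wpM2l => //; apply: mulr_ge0.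
  by apply: mulr_ge0; [exact: exprn_ge0|exact: ltW].
by apply: divr_ge0; [apply: divr_ge0 => //; exact: ltW|exact: sqr_ge0].
Qed.

Lemma gauss_not_separable (eps : R) : 0 < eps ->
  exists c : R, 0 < c /\
  exists d0 : nat, forall d n : nat, (d0 <= d)%N ->
    (pi / 4 + eps) * (d%:R ^+ 2) / ln (d%:R) <= n%:R ->
    ((1 - expR (- (c * d%:R)))%:E <=
      gauss_prob (sd_of R d) (2 * n * d)
        [set w | ~ separable (vecs n d 0 w) (vecs n d n w)])%E.
Proof.
move=> eps0; have pi0 := pi_gt0 R.
pose e := 4 * eps / pi.
have e0 : 0 < e by rewrite divr_gt0// mulr_gt0.
have [del [del0 del1 delE]] := exists_small_del e0.
set c1 := pi / 4 + eps.
have c10 : 0 < c1 by rewrite addr_gt0// divr_gt0.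
have [M1 HM1] := likely_max del0 del1 c10.
have [M2 HM2] := likely_opnorm del0 c10.
have [M3 HM3] := likely_sum_abs del0 del1 c10.
have [M4 HM4] := net_asymp c10.
have [M5 HM5] := prob_asymp.
have [cf cf0 Hf] := likely_frobenius del0.
have [d0 Hd0] := eventually_ln (Num.max M1 (Num.max M2 (Num.max M3 (Num.max M4
   (Num.max M5 (Num.max cf^-1 1)))))).
exists 8^-1; split; first by rewrite invr_gt0.
exists d0 => d n dd0 Hn.
have [dpos] := Hd0 d dd0; rewrite !ge_max.
move=> /and5P[L1 L2 L3 L4 /and3P[L5 L6 L7]].
have dp : 0 < d%:R :> R by rewrite ltr0n.
have dge1 : 1 <= d%:R :> R by rewrite ler1n.
have Ld := @ln_le_nat R d dpos.
set L := ln d%:R in L1 L2 L3 L4 L5 L6 L7 Ld Hn.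
have L0 : 0 < L by lra.
have nbig := HM4 d n%:R dpos L4 Hn.
have n1 : (1 < n)%N.
  rewrite -(@ltr_nat R); apply: lt_le_trans nbig.
  by have : 1 * 4 <= d%:R * (2 * L + 4) by [apply: ler_pM => //; lra]; rewrite -/L; lra.
have np : 0 < n%:R :> R by rewrite ltr0n ltnW.
have sp : 0 < sd_of R d by exact: sd_gt0.
pose p1 : R := (expR (- (2 * d%:R)) + d%:R ^+ 3 * (2 * expR (- (d%:R / 2))))
   + 2 * expR (- (2 * d%:R)).
pose p2 : R := 3 * expR (- (2 * d%:R)) + expR (- (cf * (d * d)%:R)).
have p1_ge0 : 0 <= p1.
  by rewrite /p1 !addr_ge0 ?mulr_ge0 ?expR_ge0 ?exprn_ge0.
have p2_ge0 : 0 <= p2 by rewrite /p2 addr_ge0 ?mulr_ge0 ?expR_ge0.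
have psum : p1 + p2 <= expR (- (8^-1 * d%:R)).
  apply: le_trans (HM5 d (le_trans L5 Ld)).
  have q1 : expR (- (2 * d%:R)) <= expR (- d%:R) :> R by rewrite ler_expR; lra.
  have q2 := expR_sqr_dim_le cf0 (le_trans L6 Ld).
  by rewrite /p1 /p2; lra.
have psum1 : p1 + p2 <= 1.
  by apply: le_trans psum _; rewrite -[leRHS]expR0 ler_expR; lra.
rewrite (_ : (2 * n * d = n * d + n * d)%N); last by rewrite -mulnA mul2n addnn.
rewrite /gauss_prob gauss_iter_cat.
have lP := likely_and (HM1 d n dpos L1 Hn) (HM2 d n dpos L2 Hn).
(* For [u] in a good event the conditional probability over [v] is at least [1 - p2]; integrating
   over [u] loses a further [p1]. *)
apply: (@le_trans _ _ ((1 - p2) - p1)%:E); first by rewrite lee_fin; lra.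
apply: (likely_gauss_iter _ _ lP).
- by apply/andP; split; lra.
- by move=> u; apply: gauss_iter_ge0 => w; rewrite lee_fin indicE.
move=> u [umax uop].
set B := (1 + del) * (n%:R / d%:R).
have B0 : 0 < B by rewrite mulr_gt0 ?divr_gt0//; lra.
have uB (x : nat -> R) : \sum_(i < n) (\sum_(k < d) u (i * d + k)%N * x k) ^+ 2 <=
    B * \sum_(k < d) x k ^+ 2.
  have := uop (fun k : 'I_d => x k); rewrite dotv_sqr.
  by apply: le_trans; rewrite /dotv /vecs.
have lQ := likely_and (HM3 d n dpos L3 Hn)
   (Hf (sd_of R d) B n d (fun i k => u (i * d + k)%N) sp B0 uB).
apply: (likely_gauss_iter _ _ lQ); first by rewrite ler01 lexx.
  by move=> w; rewrite lee_fin indicE.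
move=> w [wabs wfrob].
rewrite indicE mem_set//= vecs_catw_l vecs_catw_r.
set kap := 2 * normal_peak (1 : R) in wabs.
have kap0 : 0 < kap by rewrite mulr_gt0 ?normal_peak_gt0 ?oner_neq0.
have kap2 : kap ^+ 2 = 2 / pi by exact: normal_peak1_sqr.
clearbody kap.
set g := (1 - del) * kap * sd_of R d * n%:R in wabs.
have del1' : 0 < 1 - del by lra.
have g0 : 0 < g by rewrite /g !mulr_gt0.
set t := (1 - del) * Num.sqrt (2 * L) * sd_of R d in umax.
have L20 : 0 < 2 * L by rewrite mulr_gt0.
have t0 : 0 < t by rewrite /t !mulr_gt0// sqrtr_gt0.
apply: (not_separable n1 t0 g0 umax (sum_enorm_ge_abs (ltW g0) wabs) wfrob).
have s2 : sd_of R d ^+ 2 = d%:R^-1 := sd_sqr d.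
have -> : (t * g) ^+ 2 = (1 - del) ^+ 4 * (Num.sqrt (2 * L) ^+ 2) *
    (sd_of R d ^+ 2) ^+ 2 * kap ^+ 2 * n%:R ^+ 2 by rewrite /t /g; ring.
rewrite sqr_sqrtr ?(ltW L20)// s2 kap2 natrM.
rewrite (_ : (1 + del) * _ * _ = (1 + del) ^+ 2 * n%:R); last first.
  by rewrite /B; field; rewrite gt_eqF.
apply: (sharp_gap pi0 (ltW del1') np dp L0 delE).
by rewrite -ler_pdivrMr.
Qed.

Lemma gauss_fixed_not_separable (K2 c0 : R) : 0 < K2 -> 0 < c0 ->
  exists C : R, exists c : R, 0 < c /\
  exists d0 : nat, forall (d n : nat) (v : 'I_n -> 'I_d -> R), (d0 <= d)%N ->
    C * (d%:R ^+ 2) / ln (d%:R) <= n%:R ->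
    (forall x : 'I_d -> R,
       c0 / d%:R * enorm x ^+ 2 <= n%:R^-1 * \sum_(i < n) dotv (v i) x ^+ 2) ->
    (forall x : 'I_d -> R, enorm x = 1 ->
       n%:R^-1 * \sum_(i < n) dotv (v i) x ^+ 4 <= K2 / d%:R ^+ 2) ->
    ((1 - expR (- (c * d%:R)))%:E <=
      gauss_prob (sd_of R d) (n * d)
        [set w | ~ separable (vecs n d 0 w) v])%E.
Proof.
move=> K20 c00.
have [q [q0 qE]] : exists q, 0 < q /\ q = c0 / 2 * Num.sqrt (c0 / (2 * K2)).
  exists (c0 / 2 * Num.sqrt (c0 / (2 * K2))); split => //.
  by rewrite mulr_gt0 ?divr_gt0// sqrtr_gt0 divr_gt0 ?mulr_gt0.
pose rK := Num.sqrt K2.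
have rK0 : 0 < rK by rewrite sqrtr_gt0.
(* With losses [1/2] in the maximum and 1 in the Frobenius bound, the comparison is
   [2 rK n < (q^2 / (2 d^2)) n (n L)]; it holds as soon as the numerator here exceeds [4 rK]. *)
have C0 : 0 < 5 * rK / q ^+ 2 by rewrite divr_gt0 ?mulr_gt0 ?exprn_gt0.
exists (5 * rK / q ^+ 2), 8^-1; split; first by rewrite invr_gt0.
set C := 5 * rK / q ^+ 2 in C0 *.
have half0 : 0 < 2^-1 :> R by rewrite invr_gt0.
have half1 : 2^-1 < 1 :> R by lra.
have [M1 HM1] := likely_max half0 half1 C0.
have [M4 HM4] := net_asymp C0.
have [M5 HM5] := prob_asymp.
have [cf cf0 Hf] := likely_frobenius (@ltr01 R).
have [d0 Hd0] := eventually_ln (Num.max M1 (Num.max M4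
   (Num.max M5 (Num.max cf^-1 1)))).
exists d0 => d n v dd0 Hn H2 H4.
have [dpos] := Hd0 d dd0; rewrite !ge_max.
move=> /and5P[L1 L4 L5 L6 L7].
have dp : 0 < d%:R :> R by rewrite ltr0n.
have dge1 : 1 <= d%:R :> R by rewrite ler1n.
have Ld := @ln_le_nat R d dpos.
set L := ln d%:R in L1 L4 L5 L6 L7 Ld Hn.
have L0 : 0 < L by lra.
have nbig := HM4 d n%:R dpos L4 Hn.
have n1 : (1 < n)%N.
  rewrite -(@ltr_nat R); apply: lt_le_trans nbig.
  by have : 1 * 4 <= d%:R * (2 * L + 4) by [apply: ler_pM => //; lra]; rewrite -/L; lra.
have n0 : (0 < n)%N by exact: ltnW.
have np : 0 < n%:R :> R by rewrite ltr0n.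
have sp : 0 < sd_of R d by exact: sd_gt0.
set B := rK * (n%:R / d%:R).
have B0 : 0 < B by rewrite /B mulr_gt0// divr_gt0.
pose a (i k : nat) := ext (fun i' : 'I_n => ext (v i') k) i.
have aE (i : 'I_n) (k : 'I_d) : a i k = v i k by rewrite /a !extE.
have vB (x : nat -> R) : \sum_(i < n) (\sum_(k < d) a i k * x k) ^+ 2 <=
    B * \sum_(k < d) x k ^+ 2.
  have := sum_sqr_dotv_pow4 dpos n0 (ltW K20) H4 (fun k : 'I_d => x k).
  rewrite dotv_sqr -/rK -/B; apply: le_trans.
  apply: ler_sum => i _; rewrite le_eqVlt; apply/orP; left; apply/eqP.
  by congr (_ ^+ 2); apply: eq_bigr => k _; rewrite aE.
have lP := likely_and (HM1 d n dpos L1 Hn) (Hf (sd_of R d) B n d a sp B0 vB).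
set p := (X in likely _ _ X _) in lP.
apply: (@le_trans _ _ (1 - p)%:E).
  rewrite lee_fin lerD2l lerN2.
  apply: le_trans (HM5 d (le_trans L5 Ld)).
  have q1 : expR (- (2 * d%:R)) <= expR (- d%:R) :> R by rewrite ler_expR; lra.
  have q2 := expR_sqr_dim_le cf0 (le_trans L6 Ld).
  have q3 := expR_ge0 (- d%:R : R).
  by rewrite /p; lra.
apply: (likely_prob lP) => w [umax wfrob] /=.
set t := (1 - 2^-1) * Num.sqrt (2 * L) * sd_of R d in umax.
have L20 : 0 < 2 * L by rewrite mulr_gt0.
have half1' : 0 < 1 - 2^-1 :> R by lra.
have t0 : 0 < t by rewrite /t !mulr_gt0// sqrtr_gt0.
have vlow := sum_enorm_ge_moments dpos n0 c00 K20 H2 H4.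
rewrite -qE in vlow.
have g0 : 0 < q * sd_of R d * n%:R by rewrite !mulr_gt0.
have HFr : \sum_(k < d) \sum_(l < d) (\sum_(i < n) vecs n d 0 w i k * v i l) ^+ 2 <=
    (1 + 1) * (sd_of R d ^+ 2 * B) * (d * d)%:R.
  apply: le_trans wfrob; rewrite exchange_big le_eqVlt; apply/orP; left; apply/eqP.
  apply: eq_bigr => k _; apply: eq_bigr => l _; congr (_ ^+ 2).
  by apply: eq_bigr => i _; rewrite aE mulrC /vecs.
apply: (not_separable n1 t0 g0 umax vlow HFr).
have s2 : sd_of R d ^+ 2 = d%:R^-1 := sd_sqr d.
have -> : (t * (q * sd_of R d * n%:R)) ^+ 2 = (1 - 2^-1) ^+ 2 * (Num.sqrt (2 * L) ^+ 2) *
    (sd_of R d ^+ 2) ^+ 2 * q ^+ 2 * n%:R ^+ 2 by rewrite /t; ring.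
rewrite sqr_sqrtr ?(ltW L20)// s2 natrM.
rewrite (_ : (1 + 1) * _ * _ = 2 * rK * n%:R); last first.
  by rewrite /B; field; rewrite gt_eqF.
have hc : C * d%:R ^+ 2 <= n%:R * L by rewrite -ler_pdivrMr.
rewrite [ltRHS](_ : _ = 2^-1 * n%:R * (q ^+ 2 / d%:R ^+ 2) * (n%:R * L)); last first.
  by field; rewrite !gt_eqF.
apply: (@lt_le_trans _ _ (2^-1 * n%:R * (q ^+ 2 / d%:R ^+ 2) * (C * d%:R ^+ 2))); last first.
  apply: ler_wpM2l => //; apply: mulr_ge0; first by apply: mulr_ge0 => //; exact: ltW.
  by apply: divr_ge0; exact: sqr_ge0.
rewrite [ltRHS](_ : _ = 5 / 2 * rK * n%:R); last first.
  by rewrite /C; field; rewrite !gt_eqF.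
by rewrite ltr_pM2r// ltr_pM2r//; lra.
Qed.
End final.

Theorem theorem2p3 (R : realType) :
  (* (a) *)
  (forall eps : R, 0 < eps ->
    exists c : R, 0 < c /\
    exists d0 : nat, forall d n : nat, (d0 <= d)%N ->
      (pi / 4 + eps) * (d%:R ^+ 2) / ln (d%:R) <= n%:R ->
      ((1 - expR (- (c * d%:R)))%:E <=
        gauss_prob (sd_of R d) (2 * n * d)
          [set w | ~ separable (vecs n d 0 w) (vecs n d n w)])%E)
  /\
  (* (b) *)
  (forall K1 K2 c0 : R, 0 < K1 -> 0 < K2 -> 0 < c0 ->
    exists C : R,
    exists c : R, 0 < c /\
    exists d0 : nat, forall (d n : nat) (v : 'I_n -> 'I_d -> R), (d0 <= d)%N ->
      C * (d%:R ^+ 2) / ln (d%:R) <= n%:R ->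
      (forall i, v i <> (fun _ => 0)) ->
      (forall i, enorm (v i) <= K1) ->
      (forall x : 'I_d -> R,
         c0 / d%:R * enorm x ^+ 2 <= n%:R^-1 * \sum_(i < n) dotv (v i) x ^+ 2) ->
      (forall x : 'I_d -> R, enorm x = 1 ->
         n%:R^-1 * \sum_(i < n) dotv (v i) x ^+ 4 <= K2 / d%:R ^+ 2) ->
      ((1 - expR (- (c * d%:R)))%:E <=
        gauss_prob (sd_of R d) (n * d)
          [set w | ~ separable (vecs n d 0 w) v])%E).
Proof.
split=> [eps eps0|K1 K2 c0 _ K20 c00]; first exact: gauss_not_separable.
have [C [c [c_gt0 [d0 Hd0]]]] := gauss_fixed_not_separable K20 c00.
exists C, c; split=> //; exists d0 => d n v dd0 Hn _ _ H2 H4.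
exact: Hd0.
Qed.
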